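(* Let $s\ge 0$ and let $\mathcal{C}=(\mathcal{A}^\top\mathcal{A})^{-s}$. Assume: (1) (operator spectral decay) there are $\gamma>0$ with $\gamma>1/(s+1)$ and constants $0<\underline{c}\le\overline{c}$ such that $\underline{c}\,k^{-\gamma}\le\lambda_k\le\overline{c}\,k^{-\gamma}$ for all $k\ge1$, where $\{\lambda_k\}_{k\ge1}$ are the eigenvalues of $\mathcal{A}^\top\mathcal{A}$; (2) (source condition) $\phi_*\in\ker(\mathcal{A}^\top\mathcal{A})^\perp$, and $\phi_*$ belongs to one of the two classes $\mathcal{F}_{\mathrm{Sob}}^{\tilde\beta}$ (with $\tilde\beta>0$) or $\mathcal{F}_{\mathrm{pow}}^{\tilde\beta}$ (with $\tilde\beta>\tfrac12$); let $\beta>0$ denote the smoothness exponent of that class; (3) (white noise) the data are $\mathbf{b}=\mathcal{A}\phi_*+\boldsymbol{\varepsilon}$ with $\boldsymbol{\varepsilon}$ Gaussian white noise of level $\sigma>0$ on $\mathbb{Y}$, independent of $\mathcal{A}$. Let $\hat\phi_\lambda$ be the Tikhonov estimator with regularization operator $\mathcal{C}$ and parameter $\lambda>0$. Then there are constants $C_1,C_2>0$, depending on $\gamma$, $\beta$, $s$, the spectral constants $\underline{c},\overline{c}$, the source-condition constants ($\mathcal{E}$, respectively $a_1,a_2$), and the sample size $M$, such that, with the optimal choice of regularization parameter $\lambda=\lambda_*=\lambda_*(\sigma)$, which scales as indicated, the following upper bounds hold as $\sigma\to0$ (i.e. for all sufficiently small $\sigma>0$): (i) if $\gamma>\beta/(s+1)$,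 then, with $\lambda_*\asymp\sigma^{\frac{(s+1)\gamma}{2\beta+\gamma+1}}$, $$\mathbb{E}\left[\|\hat\phi_{\lambda_*}-\phi_*\|_2^2\mid\mathcal{A}\right]\le C_1\,\sigma^{\frac{4\beta}{2\beta+\gamma+1}};$$ (ii) if $\gamma<\beta/(s+1)$, then, with $\lambda_*\asymp\sigma^{\frac{s+1}{(2s+3)+1/\gamma}}$, $$\mathbb{E}\left[\|\hat\phi_{\lambda_*}-\phi_*\|_2^2\mid\mathcal{A}\right]\le C_2\,\sigma^{\frac{4(s+1)}{(2s+3)+1/\gamma}}.$$ (Precisely: in each case there exists a choice $\lambda_*(\sigma)>0$ with the stated scaling for which the stated bound holds.)
   Context: Setting. $\mathcal{S},\Omega\subset\mathbb{R}$ are bounded domains, and $\|\cdot\|_2$ is the $L^2(\mathcal{S})$ norm. For an unknown kernel $\phi:\mathcal{S}\to\mathbb{R}$ and input function $u$, set $R_\phi[u](x)=\int_{\mathcal{S}}\phi(s)\,g[u](x,s)\,ds$, $x\in\Omega$, where $g[u]$ is a known interaction term. Given $M$ inputs $u_1,\dots,u_M$ ($M$ fixed), let $\mathbb{Y}=L^2(\Omega)^{\oplus M}$ with inner product $\langle\mathbf{f},\mathbf{g}\rangle_{\mathbb{Y}}=\frac1M\sum_{m=1}^M\int_\Omega f_m(x)g_m(x)\,dx$. The forward operator $\mathcal{A}:L^2(\mathcal{S})\to\mathbb{Y}$, $(\mathcal{A}\phi)_m=R_\phi[u_m]$, is a bounded linear operator with adjoint $\mathcal{A}^\top$. The normal operator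 $\mathcal{A}^\top\mathcal{A}$ is compact and positive semi-definite, with non-increasing eigenvalues $\{\lambda_k\}_{k\ge1}$ converging to $0$ and corresponding orthonormal eigenfunctions $\{\psi_k\}_{k\ge1}$ in $L^2(\mathcal{S})$. Noise. Conditionally on $\mathcal{A}$, $\boldsymbol{\varepsilon}$ is a centered Gaussian random linear functional on $\mathbb{Y}$ with covariance $\mathbb{E}[\langle\boldsymbol{\varepsilon},\mathbf{f}\rangle\langle\boldsymbol{\varepsilon},\mathbf{g}\rangle\mid\mathcal{A}]=\frac{\sigma^2}{M}\langle\mathbf{f},\mathbf{g}\rangle_{\mathbb{Y}}$ for all $\mathbf{f},\mathbf{g}\in\mathbb{Y}$. The equation $\mathbf{b}=\mathcal{A}\phi_*+\boldsymbol{\varepsilon}$ is read weakly: $\langle\mathbf{b},\mathbf{f}\rangle=\langle\mathcal{A}\phi_*,\mathbf{f}\rangle_{\mathbb{Y}}+\langle\boldsymbol{\varepsilon},\mathbf{f}\rangle$ for all $\mathbf{f}\in\mathbb{Y}$. The operator $\mathcal{A}$ is regarded as given; the conditional expectation is over the noise. Estimator. For a self-adjoint positive semi-definite $\mathcal{C}$ and $\lambda>0$, the Tikhonov estimator is $\hat\phi_\lambda=(\mathcal{A}^\top\mathcal{A}+\lambda^2\mathcal{C})^\dagger\mathcal{A}^\top\mathbf{b}$ ($\dagger$ = pseudo-inverse). For $\mathcal{C}=(\mathcal{A}^\top\mathcal{A})^{-s}$ (so $\mathcal{C}\psi_k=\lambda_k^{-s}\psi_k$) this means $\hat\phi_\lambda=\sum_{k:\lambda_k>0}\frac{\lambda_k^s}{\lambda_k^{s+1}+\lambda^2}\langle\mathbf{b},\mathcal{A}\psi_k\rangle\,\psi_k$.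 Smoothness classes. For $\phi=\sum_{k\ge1}c_k\psi_k$, $c_k=\langle\phi,\psi_k\rangle$, and constants $\mathcal{E}>0$, $0<a_1\le a_2$, define $\mathcal{F}_{\mathrm{Sob}}^{\tilde\beta}=\{\phi:\sum_{k\ge1}k^{2\tilde\beta}c_k^2\le\mathcal{E}\}$ and $\mathcal{F}_{\mathrm{pow}}^{\tilde\beta}=\{\phi: a_1k^{-\tilde\beta}\le|c_k|\le a_2k^{-\tilde\beta}\ \forall k\ge1\}$. The smoothness exponent of a class $\mathcal{F}$ of such functions is $\beta=\sup\{\mu>0:\sum_{k\ge1}k^{2\mu}c_k^2<\infty\text{ for all }\phi\in\mathcal{F}\}$. Notation. $f(\sigma)\asymp h(\sigma)$ means $f/h$ is bounded above and below by positive constants for all small $\sigma>0$. *)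

(* Defs.v *)
From HB Require Import structures.
From mathcomp Require Import all_boot all_order all_algebra.
From mathcomp Require Import all_classical all_reals all_analysis.

Set Implicit Arguments.
Unset Strict Implicit.
Unset Printing Implicit Defensive.

Import Order.TTheory GRing.Theory Num.Theory.
Import numFieldNormedType.Exports.

Local Open Scope classical_set_scope.
Local Open Scope ring_scope.

Section L2.
Context {R : realType}.
Implicit Types (D : set R) (f g : R -> R) (u : nat -> R -> R).

Local Notation mu := (@lebesgue_measure R).

Definition bounded_domain D : Prop :=
  [/\ D !=set0, open D, connected D & bounded_set D].

(* Elements of L^2(D) are represented by real functions on the whole line of
   which only the restriction to D matters; equality in L^2(D) is [eqL2]. *)
Definition L2 D f : Prop := f \_ D \in Lfun mu 2%:E.

Definition eqL2 D f g : Prop := {ae mu, forall x, D x -> f x = g x}.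

Definition innerL2 D f g : R := \int[mu]_(x in D) (f x * g x).

Definition normL2 D f : R := fine 'N[mu]_2%:E[EFin \o (f \_ D)]%E.

Definition cvgL2 D u f : Prop :=
  [/\ forall n, L2 D (u n), L2 D f &
      (fun n => normL2 D (u n \- f)) @ \oo --> (0 : R)].

(* A representative of the L^2(D)-limit of u; the zero function if u does not
   converge. *)
Definition limL2 D u : R -> R := xget (cst 0) [set f | cvgL2 D u f].

End L2.

Section Operators.
Context {R : realType}.
Variables (S Omega : set R) (M : nat).
Implicit Types (phi : R -> R) (f h : 'I_M -> R -> R).

Local Notation mu := (@lebesgue_measure R).

Definition inY f : Prop := forall m, L2 Omega (f m).

Definition innerY f h : R := M%:R^-1 * \sum_(m < M) innerL2 Omega (f m) (h m).

Definition normY f : R := Num.sqrt (innerY f f).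

Definition linY (a : R) f h : 'I_M -> R -> R := fun m x => a * f m x + h m x.

Definition forward (U : Type) (g : U -> R -> R -> R) (u : 'I_M -> U) phi :
    'I_M -> R -> R :=
  fun m x => \int[mu]_(s in S) (phi s * g (u m) x s).

(* The integral defining (A phi)_m(x) converges absolutely for a.e. x in Omega;
   [Rintegral] is total, so this is not implied by the definition of [forward]. *)
Definition forward_integrable (U : Type) (g : U -> R -> R -> R)
    (u : 'I_M -> U) : Prop :=
  forall phi, L2 S phi -> forall m,
    {ae mu, forall x, Omega x ->
       mu.-integrable S (fun s => (phi s * g (u m) x s)%:E)}.

Definition bounded_linear (A : (R -> R) -> 'I_M -> R -> R) : Prop :=
  [/\ forall phi, L2 S phi -> inY (A phi),
      forall a phi psi, L2 S phi -> L2 S psi -> forall m,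
        eqL2 Omega (A (fun s => a * phi s + psi s) m)
                   (linY a (A phi) (A psi) m) &
      exists B : R, forall phi, L2 S phi -> normY (A phi) <= B * normL2 S phi].

Definition is_adjoint (A : (R -> R) -> 'I_M -> R -> R)
    (At : ('I_M -> R -> R) -> R -> R) : Prop :=
  (forall f, inY f -> L2 S (At f)) /\
  (forall phi f, L2 S phi -> inY f -> innerY (A phi) f = innerL2 S phi (At f)).

Definition compact_operator (N : (R -> R) -> R -> R) : Prop :=
  forall v : nat -> R -> R, (forall n, L2 S (v n)) ->
    (exists B : R, forall n, normL2 S (v n) <= B) ->
    exists (r : nat -> nat) (f : R -> R),
      {homo r : m n / (m < n)%N} /\ cvgL2 S (fun n => N (v (r n))) f.

Definition positive_semidefinite (N : (R -> R) -> R -> R) : Prop :=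
  forall phi, L2 S phi -> 0 <= innerL2 S (N phi) phi.

Definition in_kernel (N : (R -> R) -> R -> R) phi : Prop :=
  L2 S phi /\ eqL2 S (N phi) (cst 0).

Definition kernel_orthogonal (N : (R -> R) -> R -> R) phi : Prop :=
  L2 S phi /\ forall h : R -> R, in_kernel N h -> innerL2 S phi h = 0.

(* [lam k] and [psi k] are the (k+1)-st eigenvalue and eigenfunction.  The last
   clause says that the list is exhaustive (eigenvalues with multiplicity): by
   the spectral theorem nothing but the kernel is orthogonal to all psi_k. *)
Definition eigensystem (N : (R -> R) -> R -> R) (lam : nat -> R)
    (psi : nat -> R -> R) : Prop :=
  [/\ {homo lam : j k / (j <= k)%N >-> k <= j},
      lam @ \oo --> (0 : R),
      (forall k, L2 S (psi k)) /\
      (forall j k, innerL2 S (psi j) (psi k) = (j == k)%:R),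
      forall k, eqL2 S (N (psi k)) (fun x => lam k * psi k x) &
      forall h : R -> R, L2 S h -> (forall k, innerL2 S h (psi k) = 0) -> in_kernel N h].

End Operators.

Section Noise.
Context {R : realType} {d : measure_display} {T : measurableType d}.
Variable P : probability T R.

(* The case v = 0 is the Dirac mass at m; [normal_prob m 0] is not. *)
Definition gaussian (m v : R) (X : {RV P >-> R}) : Prop :=
  if v == 0 then {ae P, forall w, X w = m}
  else forall B, measurable B ->
    distribution P X B = normal_prob m (Num.sqrt v) B.

(* Joint Gaussianity of finitely many <eps, f_i> follows from linearity. *)
Definition white_noise (Omega : set R) (M : nat) (sigma : R)
    (eps : ('I_M -> R -> R) -> {RV P >-> R}) : Prop :=
  [/\ forall a f h, inY Omega f -> inY Omega h ->
        {ae P, forall w, eps (linY a f h) w = a * eps f w + eps h w},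
      forall f, inY Omega f -> exists v : R, 0 <= v /\ gaussian 0 v (eps f) &
      forall f h, inY Omega f -> inY Omega h ->
        ('E_P[fun w => (eps f w * eps h w)%R]
          = (sigma ^+ 2 / M%:R * innerY Omega f h)%R%:E)%E].

Definition weak_data (Omega : set R) (M : nat) (Aphi : 'I_M -> R -> R)
    (eps b : ('I_M -> R -> R) -> {RV P >-> R}) : Prop :=
  forall f, inY Omega f ->
    {ae P, forall w, b f w = innerY Omega Aphi f + eps f w}.

End Noise.

Section Estimator.
Context {R : realType}.

Definition tikhonov_weight (s lambda l : R) : R :=
  if 0 < l then l `^ s / (l `^ (s + 1) + lambda ^+ 2) else 0.

(* Tikhonov estimator with C = (A^T A)^{-s} for an observed realization
   [bw f] = <b, f> of the data. *)
Definition tikhonov_partial (M : nat) (s : R)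
    (A : (R -> R) -> 'I_M -> R -> R) (lam : nat -> R) (psi : nat -> R -> R)
    (bw : ('I_M -> R -> R) -> R) (lambda : R) (n : nat) : R -> R :=
  fun x => \sum_(k < n)
    tikhonov_weight s lambda (lam k) * bw (A (psi k)) * psi k x.

Definition tikhonov (S : set R) (M : nat) (s : R)
    (A : (R -> R) -> 'I_M -> R -> R) (lam : nat -> R) (psi : nat -> R -> R)
    (bw : ('I_M -> R -> R) -> R) (lambda : R) : R -> R :=
  limL2 S (tikhonov_partial s A lam psi bw lambda).

End Estimator.

Section Smoothness.
Context {R : realType}.

(* Parameters of the classes F_Sob (exponent, E) and F_pow (exponent, a1, a2). *)
Inductive source_class : Type :=
  | Sob of R & R
  | Pow of R & R & R.

Definition source_class_valid (F : source_class) : Prop :=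
  match F with
  | Sob bt E => 0 < bt /\ 0 < E
  | Pow bt a1 a2 => [/\ 2^-1 < bt, 0 < a1 & a1 <= a2]
  end.

Variables (S : set R) (psi : nat -> R -> R).

(* phi is the sum of the series sum_k <phi, psi_k> psi_k in L^2(S) *)
Definition expands (phi : R -> R) : Prop :=
  cvgL2 S (fun n x => \sum_(k < n) innerL2 S phi (psi k) * psi k x) phi.

Definition sobolev_sum (nu : R) (phi : R -> R) : \bar R :=
  (\sum_(0 <= k <oo)
     ((k.+1%:R `^ (2 * nu) * innerL2 S phi (psi k) ^+ 2)%R)%:E)%E.

Definition in_source_class (F : source_class) (phi : R -> R) : Prop :=
  expands phi /\
  match F with
  | Sob bt E => (sobolev_sum bt phi <= E%:E)%E
  | Pow bt a1 a2 => forall k : nat,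
      a1 * k.+1%:R `^ (- bt) <= `|innerL2 S phi (psi k)|
        <= a2 * k.+1%:R `^ (- bt)
  end.

Definition smoothness_exponent (F : source_class) : \bar R :=
  ereal_sup [set nu%:E | nu in [set nu : R | 0 < nu /\
    forall phi, in_source_class F phi -> (sobolev_sum nu phi < +oo)%E]].

End Smoothness.

(* f(sigma) is of the exact order of h(sigma) as sigma -> 0+ *)
Definition same_order {R : realType} (f h : R -> R) : Prop :=
  exists a b : R, [/\ 0 < a, 0 < b &
    \forall sigma \near 0^'+, a * h sigma <= f sigma <= b * h sigma].

(* Under the parameter choice lstar, for all small noise levels: the series
   defining the estimator converges almost surely in L^2(S), and the mean
   squared error is at most C sigma^rate. *)
Definition risk_bound {R : realType} (S Omega : set R) (M : nat) (s : R)
    (A : (R -> R) -> 'I_M -> R -> R) (lam : nat -> R) (psi : nat -> R -> R)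
    (phistar : R -> R) (lstar : R -> R) (C rate : R) : Prop :=
  \forall sigma \near 0^'+,
    forall (d : measure_display) (T : measurableType d) (P : probability T R)
      (eps b : ('I_M -> R -> R) -> {RV P >-> R}),
    white_noise Omega sigma eps ->
    weak_data Omega (A phistar) eps b ->
    let est w := tikhonov S s A lam psi (fun f => b f w) (lstar sigma) in
    {ae P, forall w, cvgL2 S
       (tikhonov_partial s A lam psi (fun f => b f w) (lstar sigma)) (est w)} /\
    ('E_P[fun w => (normL2 S (est w \- phistar) ^+ 2)%R]
       <= (C * sigma `^ rate)%R%:E)%E.

(* Main.v *)
Require Import Defs.
From HB Require Import structures.
From mathcomp Require Import all_boot all_order all_algebra.
From mathcomp Require Import all_classical all_reals all_analysis.
From mathcomp Require Import measurable_realfun ring lra.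


(** In the basis psi_k the estimator is diagonal: with th_k = <phi_*, psi_k>,
    w_k the Tikhonov weight and e_k = <eps, A psi_k>, of second moment
    sigma^2 lam_k / M, its k-th coefficient differs from th_k by
    (w_k lam_k - 1) th_k + w_k e_k.  By (x + y)^2 <= 2 x^2 + 2 y^2 the risk is
    at most twice the sum of a bias series and a variance series.  Put
    K = lambda^(- 2 / a) with a = gamma (s + 1), the index at which
    lam_k^(s+1) crosses lambda^2.  Splitting both series at K bounds the
    variance by sigma^2 K^(gamma+1) and the bias by K^(- 2 min(beta, a)), up to
    constants, and the stated lambda balances the two.  Passing from
    coefficients to functions needs the completeness of L^2(S), which also
    shows that the smoothness exponent of a Sobolev class does not exceed its
    nominal exponent. *)

Set Implicit Arguments.
Unset Strict Implicit.
Unset Printing Implicit Defensive.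

Import Order.TTheory GRing.Theory Num.Theory.
Import numFieldNormedType.Exports.

Local Open Scope classical_set_scope.
Local Open Scope ring_scope.

(** * Sums of real powers *)

Section power_sums.
Context {R : realType}.
Implicit Types (a e p q x y K : R) (n k : nat).

(** Since y^a = x^a e^t with t = a (ln y - ln x), this is the tangent bound e^t >= 1 + t. It holds
    for either sign of [a], and so serves decreasing and increasing powers alike. *)
Lemma powRB_ge a x y : 0 < x -> 0 < y ->
  x `^ a * (a * (ln y - ln x)) <= y `^ a - x `^ a.
Proof.
move=> x0 y0; have -> : y `^ a = x `^ a * expR (a * (ln y - ln x)).
  rewrite /powR !gt_eqF// -expRD; congr expR; ring.
set E := expR _; have -> : x `^ a * E - x `^ a = x `^ a * (E - 1) by ring.
rewrite ler_wpM2l ?powR_ge0//.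
by have := expR_ge1Dx (a * (ln y - ln x)); rewrite -/E; lra.
Qed.

Lemma ln_succB_ge x : 0 < x -> (x + 1)^-1 <= ln (x + 1) - ln x.
Proof.
move=> x0; have y0 : 0 < x + 1 by lra.
have : ln (1 + - (x + 1)^-1) <= - (x + 1)^-1.
  by apply: le_ln1Dx; rewrite ltrN2 invf_lt1// ltrDr.
have -> : 1 - (x + 1)^-1 = x / (x + 1) by field; rewrite gt_eqF.
rewrite ln_div ?posrE//; lra.
Qed.

(** A discrete stand-in for the comparison of a sum with an integral. The factor 2^(-(q+1)) pays for
    replacing x + 1 by 2x, which is where x >= 1 enters. *)
Lemma powR_decB_ge q x : 0 < q -> 1 <= x ->
  2 `^ (- (q + 1)) * q * x `^ (- (q + 1)) <= x `^ (- q) - (x + 1) `^ (- q).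
Proof.
move=> q0 x1; have x0 : 0 < x by lra.
have y0 : 0 < x + 1 by lra.
have := powRB_ge (- q) y0 x0; apply: le_trans.
apply: (@le_trans _ _ ((x + 1) `^ (- q) * (q * (x + 1)^-1))); last first.
  rewrite ler_wpM2l ?powR_ge0// mulNr -mulrN opprB ler_wpM2l ?(ltW q0)//.
  exact: ln_succB_ge.
rewrite mulrCA -powR_inv1 ?(ltW y0)// -powRD; last first.
  by apply/implyP => _; rewrite gt_eqF.
rewrite (_ : - q - 1 = - (q + 1)); last by ring.
rewrite [X in X * _]mulrC -mulrA ler_wpM2l ?(ltW q0)// -powRM; [|lra..].
rewrite !powRN lef_pV2 ?posrE ?powR_gt0//; last lra.
apply: ge0_ler_powR; rewrite ?nnegrE; lra.
Qed.

Lemma powR_incB_ge e x : 0 < e -> 1 <= x ->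
  e / 2 * x `^ (e - 1) <= (x + 1) `^ e - x `^ e.
Proof.
move=> e0 x1; have x0 : 0 < x by lra.
have y0 : 0 < x + 1 by lra.
have := powRB_ge e x0 y0; apply: le_trans.
rewrite powRB; last by apply/implyP => _; rewrite gt_eqF.
rewrite powRr1 ?(ltW x0)//.
have -> : e / 2 * (x `^ e / x) = x `^ e * (e * (2 * x)^-1).
  by field; rewrite gt_eqF.
rewrite ler_wpM2l ?powR_ge0// ler_wpM2l ?(ltW e0)//.
by apply: le_trans (ln_succB_ge x0); rewrite lef_pV2 ?posrE; lra.
Qed.

Lemma sum_powR_tail p : 1 < p -> exists C, 0 < C /\ forall K n, 1 <= K ->
  \sum_(k < n) (if K <= k.+1%:R then k.+1%:R `^ (- p) else 0)
    <= C * K `^ (1 - p).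
Proof.
move=> p1; have q0 : 0 < p - 1 by lra.
have D0 : 0 < 2 `^ (- p) * (p - 1) by rewrite mulr_gt0// powR_gt0.
exists (2 `^ (- p) * (p - 1))^-1; split; first by rewrite invr_gt0.
(* The potential stays equal to K^(1-p) as long as k+1 <= K and follows (k+1)^(1-p) afterwards, so a
   single telescoping sum handles the indices on both sides of K. *)
move=> K n K1; pose G k := Num.max k.+1%:R K `^ (1 - p).
have G0 : G 0 = K `^ (1 - p) by rewrite /G max_r.
suff H : \sum_(k < n) (if K <= k.+1%:R then k.+1%:R `^ (- p) else 0) <=
    (2 `^ (- p) * (p - 1))^-1 * (G 0 - G n).
  apply: le_trans H _; rewrite -G0 ler_wpM2l ?invr_ge0 ?(ltW D0)//.
  by rewrite gerBl powR_ge0.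
elim: n => [|n IH]; first by rewrite big_ord0 subrr mulr0.
rewrite big_ord_recr/=.
have -> : G 0 - G n.+1 = (G 0 - G n) + (G n - G n.+1) by ring.
rewrite mulrDr lerD// -ler_pdivrMl ?invr_gt0// invrK; case: ifPn => Kn.
  have := @powR_decB_ge (p - 1) n.+1%:R q0; rewrite subrK ler1n => /(_ isT).
  rewrite opprB /G (max_l Kn) -[n.+2%:R]natr1 max_l//; lra.
rewrite mulr0 subr_ge0 /G -[1 - p]opprB 2!powRN lef_pV2 ?posrE ?powR_gt0//.
- apply: ge0_ler_powR; rewrite ?(ltW q0)// ?nnegrE ?le_max ?ler0n//.
  by move: Kn; rewrite -ltNge => /ltW Kn; rewrite (max_r Kn) lexx orbT.
- by rewrite lt_max ltr0n.
- by rewrite lt_max ltr0n.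
Qed.

Lemma sum_powR_head e : 0 < e -> exists C, 0 < C /\ forall K n, 1 <= K ->
  \sum_(k < n) (if k.+1%:R <= K then k.+1%:R `^ (e - 1) else 0) <= C * K `^ e.
Proof.
move=> e0; have D0 : 0 < e / 2 by rewrite divr_gt0.
exists ((e / 2)^-1 * 2 `^ e); split.
  by rewrite mulr_gt0 ?invr_gt0 ?powR_gt0.
(* Truncating at K + 1 rather than K leaves the increment from k+1 to k+2 intact whenever k+1 <= K.
   The final value is at most (K + 1)^e <= (2K)^e, hence the factor 2^e. *)
move=> K n K1; pose G k := Num.min k.+1%:R (K + 1) `^ e.
have HG : G n <= 2 `^ e * K `^ e.
  rewrite -powRM//; last lra.
  apply: ge0_ler_powR; rewrite ?(ltW e0)// ?nnegrE; [|lra|].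
    by rewrite le_min ler0n; lra.
  by rewrite ge_min; apply/orP; right; lra.
suff H : \sum_(k < n) (if k.+1%:R <= K then k.+1%:R `^ (e - 1) else 0) <=
    (e / 2)^-1 * (G n - G 0).
  apply: le_trans H _; rewrite -mulrA ler_wpM2l ?invr_ge0 ?(ltW D0)//.
  by apply: le_trans HG; rewrite gerBl powR_ge0.
elim: n {HG} => [|n IH]; first by rewrite big_ord0 subrr mulr0.
rewrite big_ord_recr/=.
have -> : G n.+1 - G 0 = (G n - G 0) + (G n.+1 - G n) by ring.
rewrite mulrDr lerD// -ler_pdivrMl ?invr_gt0// invrK; case: ifPn => Kn.
  have := @powR_incB_ge e n.+1%:R e0; rewrite ler1n => /(_ isT).
  rewrite /G min_l; last lra.
  by rewrite -[n.+2%:R]natr1 min_l//; lra.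
rewrite mulr0 subr_ge0 /G; apply: ge0_ler_powR; rewrite ?(ltW e0)// ?nnegrE.
- by rewrite le_min ler0n; lra.
- by rewrite le_min ler0n; lra.
- by rewrite le_min !ge_min ler_nat leqnSn lexx orbT.
Qed.

End power_sums.

(** * Filter factors *)

Section tikhonov_filter.
Context {R : realType}.
Implicit Types (s lambda l K m x a clo : R).

Lemma tikhonov_weightE s lambda l : 0 < l ->
  tikhonov_weight s lambda l = l `^ s / (l `^ s * l + lambda ^+ 2).
Proof.
move=> l0; rewrite /tikhonov_weight l0 powRD ?powRr1 ?(ltW l0)//.
by apply/implyP => _; rewrite gt_eqF.
Qed.

(** Drop lambda^2 from the denominator: the weight is at most 1/l. This is the efficient bound for
    large eigenvalues. *)
Lemma variance_le_low s lambda l : 0 < l ->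
  tikhonov_weight s lambda l ^+ 2 * l <= l^-1.
Proof.
move=> l0; rewrite tikhonov_weightE//; set t := l `^ s.
have t0 : 0 < t by exact: powR_gt0.
have D0 : 0 < t * l + lambda ^+ 2 by rewrite ltr_wpDr ?sqr_ge0 ?mulr_gt0.
have H : t / (t * l + lambda ^+ 2) <= l^-1.
  by rewrite ler_pdivrMr// mulrC ler_pdivlMr// lerDl sqr_ge0.
have : (t / (t * l + lambda ^+ 2)) ^+ 2 <= l^-1 ^+ 2.
  by rewrite lerXn2r ?nnegrE ?divr_ge0 ?invr_ge0 ?(ltW t0) ?(ltW D0) ?(ltW l0).
rewrite -(ler_pM2r l0) => /le_trans; apply.
by rewrite expr2 -mulrA mulVf ?gt_eqF// mulr1.
Qed.

(** Drop l^(s+1) from the denominator instead: the weight is at most l^s / lambda^2. This is the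
    efficient bound for small eigenvalues. *)
Lemma variance_le_high s lambda l : 0 < l -> 0 < lambda ->
  tikhonov_weight s lambda l ^+ 2 * l <=
    l `^ (2 * s + 1) * (lambda ^+ 2) ^- 2.
Proof.
move=> l0 lam0; rewrite tikhonov_weightE//.
have -> : l `^ (2 * s + 1) = (l `^ s) ^+ 2 * l.
  rewrite powRD; last by apply/implyP => _; rewrite gt_eqF.
  by rewrite powRr1 ?(ltW l0)// [2 * s]mulrC powRrM powR_mulrn ?powR_ge0.
set t := l `^ s; have t0 : 0 < t by exact: powR_gt0.
have L0 : 0 < lambda ^+ 2 by rewrite exprn_gt0.
rewrite [leRHS]mulrAC ler_pM2r// -exprVn -exprMn.
rewrite lerXn2r ?nnegrE ?divr_ge0 ?invr_ge0 ?addr_ge0 ?mulr_ge0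
  ?(ltW t0) ?(ltW l0) ?(ltW lam0)//.
rewrite ler_pM2l// lef_pV2 ?posrE ?addr_gt0 ?mulr_gt0// lerDr.
by rewrite mulr_ge0 ?(ltW t0) ?(ltW l0).
Qed.

(* The two bounds 1 and K^{-2a} l^{-2(s+1)} on the squared bias filter,
   interpolated: min(1, y^{2a}) <= y^{2m} for 0 <= m <= a. *)
Lemma bias_filter_le s lambda l K x m a clo : 0 < clo -> 0 < l -> 0 <= s ->
  0 < K -> 0 < x -> 0 <= m <= a ->
  lambda ^+ 2 = K `^ (- a) -> clo * x `^ (- a) <= l `^ (s + 1) ->
  (tikhonov_weight s lambda l * l - 1) ^+ 2 <=
    Num.max 1 (clo ^- 2) * (x / K) `^ (2 * m).
Proof.
move=> clo0 l0 s0 K0 x0 /andP[m0 ma] LE lE.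
have t0 : 0 < l `^ (s + 1) by exact: powR_gt0.
have L0 : 0 < lambda ^+ 2 by rewrite LE powR_gt0.
have D0 : 0 < l `^ (s + 1) + lambda ^+ 2 by rewrite addr_gt0.
(* [r] is the residual filter 1 - w l, with w the Tikhonov weight. *)
pose r := lambda ^+ 2 / (l `^ (s + 1) + lambda ^+ 2).
have r0 : 0 <= r by rewrite divr_ge0 ?(ltW L0) ?(ltW D0).
have -> : (tikhonov_weight s lambda l * l - 1) ^+ 2 = r ^+ 2.
  rewrite -sqrrN; congr (_ ^+ 2); rewrite /r /tikhonov_weight l0.
  have E : l `^ (s + 1) = l `^ s * l.
    rewrite powRD ?powRr1 ?(ltW l0)//.
    by apply/implyP => _; rewrite gt_eqF.
  rewrite E; field; rewrite -E gt_eqF//.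
have y0 : 0 < x / K by rewrite divr_gt0.
have M1 : 1 <= Num.max 1 (clo ^- 2) by rewrite le_max lexx.
have r1 : r ^+ 2 <= 1.
  rewrite expr_le1//; rewrite ler_pdivrMr// mul1r lerDr ltW//.
have r2 : r ^+ 2 <= clo ^- 2 * (x / K) `^ (2 * a).
  have H : r <= clo^-1 * (x / K) `^ a.
    apply: (@le_trans _ _ (lambda ^+ 2 / l `^ (s + 1))).
      by rewrite /r ler_pM2l// lef_pV2 ?posrE// lerDl ltW.
    apply: (@le_trans _ _ (lambda ^+ 2 / (clo * x `^ (- a)))).
      by rewrite ler_pM2l// lef_pV2 ?posrE// mulr_gt0// powR_gt0.
    rewrite LE powRM ?(ltW x0) ?invr_ge0 ?(ltW K0)//.
    rewrite -[K^-1]powR_inv1 ?(ltW K0)// -powRrM mulN1r !powRN invfM invrK.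
    by rewrite mulrCA [X in _ <= _ * X]mulrC.
  have -> : clo ^- 2 * (x / K) `^ (2 * a) = (clo^-1 * (x / K) `^ a) ^+ 2.
    rewrite exprMn exprVn; congr (_ * _).
    by rewrite [2 * a]mulrC powRrM powR_mulrn ?powR_ge0.
  by rewrite lerXn2r ?nnegrE// mulr_ge0 ?powR_ge0 ?invr_ge0 ?(ltW clo0).
have [y1|y1] := leP 1 (x / K).
  apply: (le_trans r1); rewrite -[leLHS]mulr1 ler_pM//.
  by rewrite -[leLHS](powRr0 (x / K)) ler_powR// mulr_ge0.
apply: (le_trans r2); rewrite ler_pM ?powR_ge0 ?invr_ge0 ?sqr_ge0//.
  by rewrite le_max lexx orbT.
by apply: ger_powR; rewrite ?y0 ?(ltW y1)// ler_pM2l.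
Qed.

End tikhonov_filter.

(** * Bias and variance series *)

Section rate_sums.
Context {R : realType}.
Implicit Types (s gamma clo chi beta lambda K m E : R) (lam th : nat -> R).

Definition spectral_decay gamma clo chi lam : Prop :=
  forall k : nat, clo * k.+1%:R `^ (- gamma) <= lam k
                    <= chi * k.+1%:R `^ (- gamma).

Lemma spectral_decay_gt0 gamma clo chi lam k : 0 < clo ->
  spectral_decay gamma clo chi lam -> 0 < lam k.
Proof.
move=> clo0 /(_ k)/andP[+ _]; apply: lt_le_trans.
by rewrite mulr_gt0// powR_gt0// ltr0n.
Qed.

(** Up to K there are about K terms, each at most 1 / lam_k, of order K^gamma. Beyond K the terms
    are of order lambda^(-4) k^(-p) with p = gamma (2s + 1), and lambda^(-4) = K^(2a) turns their
    sum into K^(2a + 1 - p) = K^(gamma + 1). The tail is summable because gamma (s + 1) > 1 forces p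
    > 1. *)
Lemma variance_sum_le s gamma clo chi : 0 <= s -> 0 < gamma ->
    1 / (s + 1) < gamma -> 0 < clo -> 0 < chi ->
  exists C, 0 < C /\ forall lam lambda K n, spectral_decay gamma clo chi lam ->
    1 <= K -> 0 < lambda -> lambda ^+ 2 = K `^ (- (gamma * (s + 1))) ->
    \sum_(k < n) tikhonov_weight s lambda (lam k) ^+ 2 * lam k
      <= C * K `^ (gamma + 1).
Proof.
move=> s0 g0 sg clo0 chi0; set a := gamma * (s + 1).
pose p := gamma * (2 * s + 1).
have s1 : 0 < s + 1 by lra.
have p1 : 1 < p.
  move: sg; rewrite ltr_pdivrMr// /p => sg.
  have := mulr_ge0 (ltW g0) s0; lra.
have [C1 [C10 HC1]] := @sum_powR_tail R p p1.
(* With exponent e = 1 the summands are k^0 = 1: the head sum counts the indices up to K. *)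
have [C2 [C20 HC2]] := @sum_powR_head R 1 ltr01.
exists (clo^-1 * C2 + chi `^ (2 * s + 1) * C1); split.
  by rewrite addr_gt0// mulr_gt0 ?invr_gt0// powR_gt0.
move=> lam lambda K n dec K1 lam0 LE; have K0 : 0 < K by lra.
rewrite mulrDl.
have -> : clo^-1 * C2 * K `^ (gamma + 1) =
    (clo^-1 * K `^ gamma) * (C2 * K `^ 1).
  rewrite powRD; last by apply/implyP => _; rewrite gt_eqF.
  ring.
have -> : chi `^ (2 * s + 1) * C1 * K `^ (gamma + 1) =
    (chi `^ (2 * s + 1) * (lambda ^+ 2) ^- 2) * (C1 * K `^ (1 - p)).
  have -> : (lambda ^+ 2) ^- 2 = K `^ (a * 2).
    by rewrite LE powRN exprVn invrK powRrM powR_mulrn ?powR_ge0.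
  have -> : gamma + 1 = a * 2 + (1 - p) by rewrite /a /p; ring.
  rewrite [K `^ _]powRD; last by apply/implyP => _; rewrite gt_eqF.
  ring.
have kpos k : 0 < k.+1%:R :> R by rewrite ltr0n.
apply: le_trans (lerD (ler_wpM2l _ (HC2 K n K1)) (ler_wpM2l _ (HC1 K n K1)));
  [|by rewrite mulr_ge0 ?invr_ge0 ?powR_ge0 ?(ltW clo0)
   |by rewrite mulr_ge0 ?powR_ge0 ?invr_ge0 ?exprn_ge0 ?(ltW lam0)].
rewrite 2!mulr_sumr -big_split/=; apply: ler_sum => k _.
have l0 := spectral_decay_gt0 k clo0 dec.
have /andP[l1 l2] := dec k.
case: (leP k.+1%:R K) => kK.
  apply: ler_wpDr.
    rewrite mulr_ge0// ?mulr_ge0 ?powR_ge0 ?invr_ge0 ?exprn_ge0 ?(ltW lam0)//.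
    by case: ifP => // _; rewrite powR_ge0.
  rewrite subrr powRr0 mulr1; apply: (le_trans (variance_le_low _ _ l0)).
  apply: (@le_trans _ _ (clo * k.+1%:R `^ (- gamma))^-1).
    by rewrite lef_pV2 ?posrE// mulr_gt0// powR_gt0.
  rewrite invfM powRN invrK ler_wpM2l ?invr_ge0 ?(ltW clo0)//.
  by apply: ge0_ler_powR; rewrite ?(ltW g0)// nnegrE ltW.
rewrite mulr0 add0r (ltW kK).
apply: (le_trans (variance_le_high _ l0 lam0)).
rewrite [leRHS]mulrAC; apply: ler_wpM2r.
  by rewrite invr_ge0 ?exprn_ge0 ?(ltW lam0).
apply: (@le_trans _ _ ((chi * k.+1%:R `^ (- gamma)) `^ (2 * s + 1))).
  apply: ge0_ler_powR => //; rewrite ?nnegrE ?(ltW l0)//; first by lra.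
  by rewrite mulr_ge0 ?powR_ge0 ?(ltW chi0).
rewrite powRM ?powR_ge0 ?(ltW chi0)// -powRrM mulNr//.
Qed.

(** The constant of [bias_filter_le] for the lower bound clo^(s+1) k^(-a) on lam_k^(s+1). *)
Definition bias_constant s clo : R := Num.max 1 ((clo `^ (s + 1)) ^- 2).

Lemma bias_constant_ge1 s clo : 1 <= bias_constant s clo.
Proof. by rewrite /bias_constant le_max lexx. Qed.

(** The free exponent [m] is chosen by the caller: m = 0 is the trivial bound, m = a the strongest
    decay that the filter can exploit, and intermediate values match the smoothness of the
    solution. *)
Lemma bias_term_le s gamma clo chi lam lambda K m k : 0 <= s -> 0 < gamma ->
    0 < clo -> spectral_decay gamma clo chi lam ->
    1 <= K -> lambda ^+ 2 = K `^ (- (gamma * (s + 1))) ->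
    0 <= m <= gamma * (s + 1) ->
  (tikhonov_weight s lambda (lam k) * lam k - 1) ^+ 2 <=
    bias_constant s clo * K `^ (- (2 * m)) * k.+1%:R `^ (2 * m).
Proof.
move=> s0 g0 clo0 dec K1 LE mI; have K0 : 0 < K by lra.
have l0 := spectral_decay_gt0 k clo0 dec.
have k0 : 0 < k.+1%:R :> R by rewrite ltr0n.
have c0 : 0 < clo `^ (s + 1) by rewrite powR_gt0.
have := bias_filter_le c0 l0 s0 K0 k0 mI LE.
rewrite powRM ?invr_ge0 ?(ltW K0) ?(ltW k0)//.
rewrite -[K^-1]powR_inv1 ?(ltW K0)// -[(K `^ (-1)) `^ _]powRrM mulN1r.
rewrite mulrA mulrAC; apply.
rewrite -mulNr powRrM -powRM ?powR_ge0 ?(ltW clo0)//.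
have /andP[+ _] := dec k; move=> l1.
apply: ge0_ler_powR; last exact: l1; rewrite ?nnegrE ?(ltW l0)//; first lra.
by rewrite mulr_ge0 ?powR_ge0 ?(ltW clo0).
Qed.

(** The filter bound contributes k^(2m) <= k^(2 beta), which the Sobolev sum absorbs, so the factor
    K^(-2m) comes out of the series. *)
Lemma bias_sum_sobolev_le s gamma clo beta m E : 0 <= s -> 0 < gamma ->
    0 < clo -> 0 <= m <= gamma * (s + 1) -> m <= beta -> 0 < E ->
  exists C, 0 < C /\ forall chi lam lambda K th n,
    spectral_decay gamma clo chi lam ->
    1 <= K -> lambda ^+ 2 = K `^ (- (gamma * (s + 1))) ->
    \sum_(k < n) k.+1%:R `^ (2 * beta) * th k ^+ 2 <= E ->
    \sum_(k < n) (tikhonov_weight s lambda (lam k) * lam k - 1) ^+ 2 * th k ^+ 2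
      <= C * K `^ (- (2 * m)).
Proof.
move=> s0 g0 clo0 mI mb E0; have D1 := bias_constant_ge1 s clo.
exists (bias_constant s clo * E); split; first by rewrite mulr_gt0//; lra.
move=> chi lam lambda K th n dec K1 LE HE.
rewrite mulrAC; set D := _ * K `^ _.
have D0 : 0 <= D by rewrite mulr_ge0 ?powR_ge0//; lra.
apply: le_trans (ler_wpM2l D0 HE); rewrite mulr_sumr; apply: ler_sum => k _.
rewrite [leRHS]mulrA; apply: ler_wpM2r; first exact: sqr_ge0.
apply: (le_trans (bias_term_le k s0 g0 clo0 dec K1 LE mI)).
apply: ler_wpM2l => //; rewrite ler_powR ?ler1n//; lra.
Qed.

(** With the filter bound at m = a the terms are K^(-2a) k^(2a - 2 beta - 1). Whether this power of
    k is summable depends on the sign of beta - a; at equality the sum up to K would contribute a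
    logarithm. *)
Lemma bias_sum_power_le s gamma clo beta a2 : 0 <= s -> 0 < gamma ->
    0 < clo -> 0 < beta -> beta != gamma * (s + 1) -> 0 < a2 ->
  exists C, 0 < C /\ forall chi lam lambda K th n,
    spectral_decay gamma clo chi lam ->
    1 <= K -> lambda ^+ 2 = K `^ (- (gamma * (s + 1))) ->
    (forall k : nat, th k ^+ 2 <= a2 * k.+1%:R `^ (- (2 * beta + 1))) ->
    \sum_(k < n) (tikhonov_weight s lambda (lam k) * lam k - 1) ^+ 2 * th k ^+ 2
      <= C * K `^ (- (2 * Num.min beta (gamma * (s + 1)))).
Proof.
move=> s0 g0 clo0 b0 bna a20; set a := gamma * (s + 1).
have a0 : 0 < a by rewrite mulr_gt0//; lra.
pose D := bias_constant s clo; have D1 : 1 <= D := bias_constant_ge1 s clo.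
have D0 : 0 < D by lra.
have kpos k : 0 < k.+1%:R :> R by rewrite ltr0n.
have kD k (x y : R) : k.+1%:R `^ (x + y) = k.+1%:R `^ x * k.+1%:R `^ y :> R.
  by rewrite powRD//; apply/implyP => _; rewrite gt_eqF.
move: bna; rewrite neq_lt => /orP[ba|ab].
  (* For beta < a, the bound with m = a is used up to K, where the sum grows like K^(2a - 2 beta).
     Beyond K the trivial bound m = 0 leaves the tail of k^(-(2 beta + 1)). Both parts are of order
     K^(-2 beta). *)
  have p1 : 1 < 2 * beta + 1 by lra.
  have e0 : 0 < 2 * a - 2 * beta by rewrite /a; lra.
  have [C1 [C10 HC1]] := @sum_powR_tail R _ p1.
  rewrite (_ : 1 - (2 * beta + 1) = - (2 * beta)) in HC1; last by ring.
  have [C2 [C20 HC2]] := @sum_powR_head R _ e0.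
  exists (D * a2 * (C2 + C1)); split.
    by rewrite !mulr_gt0// addr_gt0.
  move=> chi lam lambda K th n dec K1 LE Hth; have K0 : 0 < K by lra.
  rewrite (min_l (ltW ba)) -[leRHS]mulrA mulrDl.
  have -> : C2 * K `^ (- (2 * beta)) =
      K `^ (- (2 * a)) * (C2 * K `^ (2 * a - 2 * beta)).
    rewrite mulrCA -powRD; last by apply/implyP => _; rewrite gt_eqF.
    by congr (_ * _ `^ _); ring.
  have Da0 : 0 <= D * a2 by rewrite mulr_ge0 ?(ltW D0) ?(ltW a20).
  apply: le_trans (ler_wpM2l Da0
    (lerD (ler_wpM2l (powR_ge0 _ _) (HC2 K n K1)) (HC1 K n K1))).
  rewrite mulr_sumr -big_split/= mulr_sumr; apply: ler_sum => k _.
  have t0 : 0 <= th k ^+ 2 by exact: sqr_ge0.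
  have r0 := sqr_ge0 (tikhonov_weight s lambda (lam k) * lam k - 1).
  rewrite mulrDr; case: (leP k.+1%:R K) => kK.
    apply: ler_wpDr.
      by rewrite mulr_ge0//; case: ifP => // _; rewrite powR_ge0.
    have mI : 0 <= a <= gamma * (s + 1) by rewrite lexx ltW.
    apply: le_trans (ler_pM r0 t0 (bias_term_le k s0 g0 clo0 dec K1 LE mI)
      (Hth k)) _.
    have -> : 2 * a - 2 * beta - 1 = 2 * a + - (2 * beta + 1) by ring.
    by rewrite kD -/D le_eqVlt; apply/orP; left; apply/eqP; ring.
  have mI : 0 <= (0 : R) <= gamma * (s + 1) by rewrite lexx ltW.
  rewrite !mulr0 add0r (ltW kK).
  apply: le_trans (ler_pM r0 t0 (bias_term_le k s0 g0 clo0 dec K1 LE mI)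
    (Hth k)) _.
  by rewrite mulr0 oppr0 !powRr0 !mulr1 mulrA.
(* For beta > a the filter saturates: the bound with m = a is summable over all k, and the tail
   lemma with cutoff 1 bounds the whole series. *)
have p1 : 1 < 2 * beta - 2 * a + 1 by rewrite /a; lra.
have [C1 [C10 HC1]] := @sum_powR_tail R _ p1.
exists (D * a2 * C1); split; first by rewrite !mulr_gt0.
move=> chi lam lambda K th n dec K1 LE Hth; have K0 : 0 < K by lra.
rewrite (min_r (ltW ab)) mulrAC.
have := HC1 1 n (lexx 1); rewrite powR1 mulr1 => HC.
have DK0 : 0 <= D * a2 * K `^ (- (2 * a)).
  by rewrite !mulr_ge0 ?powR_ge0 ?(ltW D0) ?(ltW a20).
apply: le_trans (ler_wpM2l DK0 HC).
rewrite mulr_sumr; apply: ler_sum => k _; rewrite ler1n/=.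
have mI : 0 <= a <= gamma * (s + 1) by rewrite lexx ltW.
apply: le_trans (ler_pM (sqr_ge0 _) (sqr_ge0 _)
  (bias_term_le k s0 g0 clo0 dec K1 LE mI) (Hth k)) _.
have -> : - (2 * beta - 2 * a + 1) = 2 * a + - (2 * beta + 1) by ring.
by rewrite kD -/D le_eqVlt; apply/orP; left; apply/eqP; ring.
Qed.

End rate_sums.

(** * The space L2 *)

Section L2_space.
Context {R : realType}.
(* [lebesgue_measure] lives on [measurableTypeR R], whose measurable structure
   is not convertible to the default one of [R]. *)
Local Notation RT := (measurableTypeR R).
Variable D : set RT.
Hypothesis mD : measurable D.
Implicit Types (f g h : RT -> R) (a b : R) (n : nat).

Local Notation mu := (@lebesgue_measure R).

(** Trades the zero extension [f \_ D] of the definition for conditions on [D] itself, the form in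
    which the integration lemmas apply. *)
Lemma L2P f : L2 D f <->
  measurable_fun D f /\ mu.-integrable D (EFin \o (fun x => f x ^+ 2)).
Proof.
have E : (EFin \o (fun x => f x ^+ 2)) \_ D =
    EFin \o (fun x => (f \_ D) x ^+ 2).
  by apply/funext => x; rewrite /patch/=; case: ifP => //; rewrite expr0n.
rewrite /L2; split=> [Lf|[mf intf]].
  split.
    apply/(measurable_restrictT _ mD).
    by move: Lf; rewrite inE => /andP[/[!inE]].
  by apply/integrable_mkcond => //; rewrite E; exact: Lfun2_integrable_sqr.
have mfD : measurable_fun (setT : set RT) (f \_ D).
  exact/(measurable_restrictT _ mD).
rewrite inE; apply/andP; split; rewrite inE//=.
rewrite /finite_norm unlock /Lnorm poweR_lty//.
have := (integrable_mkcond _ mD).1 intf; rewrite E => /integrableP[_].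
apply: le_lt_trans; rewrite le_eqVlt; apply/orP; left; apply/eqP.
apply: eq_integral => x _ /=; rewrite powR_mulrn// real_normK ?num_real//.
by rewrite ger0_norm ?sqr_ge0.
Qed.

Lemma L2_measurable f : L2 D f -> measurable_fun D f.
Proof. by case/L2P. Qed.

Lemma L2_lin a f g : L2 D f -> L2 D g -> L2 D (fun x => a * f x + g x).
Proof.
move=> Lf Lg; rewrite /L2.
have -> : (fun x => a * f x + g x) \_ D = a *: (f \_ D : R -> R) + g \_ D.
  apply/funext => x; rewrite -[RHS]/(a * (f \_ D) x + (g \_ D) x) /patch.
  by case: ifP => // _; rewrite mulr0 addr0.
by have [_ ] := Lfun_submod_closed mu (lee1n 2); exact.
Qed.


Lemma L2_cst0 : L2 D (cst 0).
Proof.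
apply/L2P; split; first exact: measurable_cst.
rewrite (_ : _ \o _ = cst 0%E); first exact: integrable0.
by apply/funext => x /=; rewrite expr0n.
Qed.

Lemma L2_scale a f : L2 D f -> L2 D (fun x => a * f x).
Proof.
move=> Lf; have := L2_lin a Lf L2_cst0.
by congr (L2 D _); apply/funext => x; rewrite addr0.
Qed.

Lemma L2_add f g : L2 D f -> L2 D g -> L2 D (f \+ g).
Proof.
move=> Lf Lg; have := L2_lin 1 Lf Lg.
by congr (L2 D _); apply/funext => x; rewrite mul1r.
Qed.

Lemma L2_sub f g : L2 D f -> L2 D g -> L2 D (f \- g).
Proof.
move=> Lf Lg; have := L2_lin (-1) Lg Lf.
by congr (L2 D _); apply/funext => x; rewrite mulN1r addrC.
Qed.

Lemma L2_sum n (c : nat -> R) (u : nat -> RT -> R) : (forall k, L2 D (u k)) ->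
  L2 D (fun x => \sum_(k < n) c k * u k x).
Proof.
move=> Lu; elim: n => [|n IH].
  by under eq_fun do rewrite big_ord0; exact: L2_cst0.
under eq_fun do rewrite big_ord_recr/= addrC.
exact: L2_lin.
Qed.

Lemma L2_mul_integrable f g : L2 D f -> L2 D g ->
  mu.-integrable D (EFin \o (fun x => f x * g x)).
Proof.
move=> /L2P[mf If] /L2P[mg Ig].
apply: (@le_integrable _ _ _ _ _ mD _
  (EFin \o (fun x => f x ^+ 2 + g x ^+ 2))).
- by apply/measurable_EFinP; exact: measurable_funM.
- move=> x _ /=; rewrite lee_fin.
  rewrite [leRHS]ger0_norm ?addr_ge0 ?sqr_ge0// ler_norml.
  by apply/andP; split; nra.
- by apply: eq_integrable (integrableD mD If Ig).
Qed.

Local Notation "'<<' f , g '>>'" := (innerL2 D f g).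

Lemma innerL2C f g : <<f, g>> = <<g, f>>.
Proof. by apply: eq_Rintegral => x _; rewrite mulrC. Qed.

Lemma innerL2_lin a f g h : L2 D f -> L2 D g -> L2 D h ->
  <<(fun x => (a * f x + g x)%R), h>> = a * <<f, h>> + <<g, h>>.
Proof.
move=> Lf Lg Lh; rewrite /innerL2 -RintegralZl//; last exact: L2_mul_integrable.
rewrite -RintegralD//; last exact: L2_mul_integrable.
  by apply: eq_Rintegral => x _; rewrite mulrDl mulrA.
have := L2_mul_integrable (L2_scale a Lf) Lh.
by apply: eq_integrable => // x _; rewrite /= mulrA.
Qed.

Lemma normL2_ge0 f : 0 <= normL2 D f.
Proof. by rewrite fine_ge0// Lnorm_ge0. Qed.

Lemma EFin_innerL2 f : L2 D f ->
  (<<f, f>>%:E = \int[mu]_(x in D) (f x ^+ 2)%:E)%E.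
Proof.
move=> /L2P[_ If]; rewrite /innerL2 /Rintegral fineK.
  by [].
exact: (integrable_fin_num mD If).
Qed.

Lemma normL2_sqr f : L2 D f -> normL2 D f ^+ 2 = <<f, f>>.
Proof.
move=> Lf; apply/EFin_inj; rewrite EFin_innerL2//.
have fin : ('N[mu]_2%:E[EFin \o (f \_ D)] \is a fin_num)%E.
  rewrite ge0_fin_numE ?Lnorm_ge0//.
  by move: Lf; rewrite /L2 inE => /andP[_]; rewrite inE.
rewrite -powR_mulrn ?normL2_ge0// -poweR_EFin fineK// poweR_Lnorm//.
rewrite [RHS]integral_mkcond; apply: eq_integral => x _.
rewrite /= powR_mulrn// real_normK ?num_real// /patch.
by case: ifP => //; rewrite expr0n.
Qed.

Lemma normL2E f : L2 D f -> normL2 D f = Num.sqrt <<f, f>>.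
Proof. by move=> Lf; rewrite -normL2_sqr// sqrtr_sqr ger0_norm ?normL2_ge0. Qed.

Lemma innerL2_lin_sqr a f g : L2 D f -> L2 D g ->
  normL2 D (fun x => a * f x + g x) ^+ 2 =
    a ^+ 2 * normL2 D f ^+ 2 + 2 * a * <<f, g>> + normL2 D g ^+ 2.
Proof.
move=> Lf Lg; have Lfg := L2_lin a Lf Lg.
rewrite !normL2_sqr// innerL2_lin// [<<f, _>>]innerL2C [<<g, _>>]innerL2C.
by rewrite !innerL2_lin// [<<g, f>>]innerL2C; ring.
Qed.

Lemma cauchy_schwarz_L2 f g : L2 D f -> L2 D g ->
  `|<<f, g>>| <= normL2 D f * normL2 D g.
Proof.
move=> Lf Lg.
have H a : 0 <= a ^+ 2 * normL2 D f ^+ 2 + 2 * a * <<f, g>> + normL2 D g ^+ 2.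
  by rewrite -innerL2_lin_sqr// sqr_ge0.
have nf := normL2_ge0 f; have ng := normL2_ge0 g.
rewrite -ler_sqr ?nnegrE ?mulr_ge0// real_normK ?num_real//.
move: nf ng H; set F := normL2 D f; set G := normL2 D g; set C := <<f, g>>.
move=> F0 G0 H; have [F_eq0|Fn0] := eqVneq F 0.
  have [->|Cn0] := eqVneq C 0; first by rewrite expr0n sqr_ge0.
  (* When the norm of [f] vanishes, the quadratic in [a] is affine with slope 2C; this [a] gives it
     the value -1. *)
  have := H (- (G ^+ 2 + 1) / (2 * C)); rewrite F_eq0.
  have -> : (- (G ^+ 2 + 1) / (2 * C)) ^+ 2 * 0 ^+ 2 +
    2 * (- (G ^+ 2 + 1) / (2 * C)) * C + G ^+ 2 = -1 by field.
  by rewrite lerNr oppr0 ler10.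
(* The minimizer of the quadratic. *)
have := H (- C / F ^+ 2).
have -> : (- C / F ^+ 2) ^+ 2 * F ^+ 2 + 2 * (- C / F ^+ 2) * C + G ^+ 2 =
  ((F * G) ^+ 2 - C ^+ 2) / F ^+ 2 by field.
by rewrite pmulr_lge0 ?subr_ge0// invr_gt0 exprn_gt0// lt_def Fn0.
Qed.

Lemma minkowski_L2 f g : L2 D f -> L2 D g ->
  normL2 D (f \+ g) <= normL2 D f + normL2 D g.
Proof.
move=> Lf Lg; rewrite -ler_sqr ?nnegrE ?addr_ge0 ?normL2_ge0//.
have -> : f \+ g = (fun x => 1 * f x + g x).
  by apply/funext => x; rewrite mul1r.
rewrite innerL2_lin_sqr//.
have := le_trans (ler_norm _) (cauchy_schwarz_L2 Lf Lg).
set F := normL2 D f; set G := normL2 D g; set C := <<f, g>>; nra.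
Qed.

End L2_space.

(** * Completeness of L2 *)

Section series_facts.
Context {R : realType}.

Lemma nneseries_le (u : nat -> \bar R) (B : \bar R) :
  (forall k, (0 <= u k)%E) -> (forall n, (\sum_(k < n) u k <= B)%E) ->
  (\sum_(0 <= k <oo) u k <= B)%E.
Proof.
move=> u0 uB; apply: lime_le; first exact: is_cvg_nneseries.
by apply: nearW => n; rewrite big_mkord.
Qed.

Lemma nneseries_ge_partial (u : nat -> \bar R) n :
  (forall k, (0 <= u k)%E) ->
  (\sum_(k < n) u k <= \sum_(0 <= k <oo) u k)%E.
Proof.
move=> u0; have := @nneseries_lim_ge R u xpredT 0 n.
by rewrite big_mkord; apply.
Qed.

Lemma nneseries_fin_bound (a : nat -> R) :
  (forall k, 0 <= a k) -> (\sum_(0 <= k <oo) (a k)%:E < +oo)%E ->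
  exists B, forall n, \sum_(k < n) a k <= B.
Proof.
move=> a0 afin; exists (fine (\sum_(0 <= k <oo) (a k)%:E)%E) => n.
have a0' k : (0 <= (a k)%:E)%E by rewrite lee_fin.
rewrite -lee_fin fineK; last first.
  by rewrite ge0_fin_numE// nneseries_ge0.
by rewrite -sumEFin nneseries_ge_partial.
Qed.

Lemma is_cvg_normed_series (v : nat -> R) :
  (\sum_(0 <= k <oo) `|v k|%:E < +oo)%E -> cvgn (series v).
Proof.
move=> vfin; have [B HB] :=
  @nneseries_fin_bound (fun k => `|v k|) (fun=> normr_ge0 _) vfin.
have : cvgn (fun n => \sum_(0 <= k < n) `|v k|).
  apply: nondecreasing_is_cvgn.
    by apply/nondecreasing_seqP => n; rewrite big_nat_recr//= lerDl.
  by exists B => _ [n _ <-]; rewrite big_mkord.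
exact: normed_cvg.
Qed.

End series_facts.

Section L2_completeness.
Context {R : realType}.
Local Notation RT := (measurableTypeR R).
Local Notation mu := (@lebesgue_measure R).
Variable D : set RT.
Hypothesis mD : measurable D.
Hypothesis finD : (mu D < +oo)%E.
Implicit Types (f g h : RT -> R) (u : nat -> RT -> R).

Definition cauchyL2 u : Prop := forall e : R, 0 < e ->
  exists N, forall m n, (N <= m)%N -> (N <= n)%N -> normL2 D (u m \- u n) <= e.

(** The sum of the |u_(j+1) - u_j| has a finite integral over [D], hence is finite almost
    everywhere, and there the telescoping series converges absolutely. *)
Lemma ae_cvg_fast_subsequence u : (forall n, L2 D (u n)) ->
  (forall j, normL2 D (u j.+1 \- u j) <= 2^-1 ^+ j) ->
  {ae mu, forall x, D x -> cvgn (fun j => u j x)}.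
Proof.
move=> Lu Hu.
have [d d0 muDE] : exists2 d : R, 0 <= d & mu D = d%:E.
  exists (fine (mu D)); first exact: fine_ge0.
  by rewrite fineK// ge0_fin_numE.
pose v j x := u j.+1 x - u j x.
have Lv j : L2 D (v j) by apply: L2_sub.
have mv j : measurable_fun D (fun x : RT => `|v j x|%:E).
  apply/measurable_EFinP; apply: measurableT_comp => //.
  exact: (L2_measurable mD (Lv j)).
have intv j : (\int[mu]_(x in D) `|v j x|%:E <=
    ((2^-1 ^+ j) * (1 + d))%:E)%E.
  have w0 : 0 < (2 ^+ j : R) by rewrite exprn_gt0.
  have [mvj Iv] := (L2P mD (v j)).1 (Lv j).
  apply: (@le_trans _ _ (\int[mu]_(x in D)
      ((2 ^+ j)%:E * (v j x ^+ 2)%:E + (2^-1 ^+ j)%:E))%E).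
    apply: ge0_le_integral => //.
    - apply: emeasurable_funD => //.
      apply: measurable_funeM; apply/measurable_EFinP; exact: measurable_funX.
    - move=> x _; rewrite -EFinM -EFinD lee_fin.
      (* AM-GM: [2 |v| <= 2^j v^2 + 2^-j], so the square bound [4^-j] and
         the finite measure of D give a summable bound on [\int |v_j|]. *)
      have t0 := normr_ge0 (v j x); rewrite -(real_normK (num_real (v j x))).
      move: t0; set t := `|v j x| => t0; rewrite exprVn -(ler_pM2l w0).
      rewrite mulrDr divff ?gt_eqF//; set w := 2 ^+ j; nra.
  rewrite ge0_integralD//; last 2 first.
  - by move=> x _; rewrite -EFinM lee_fin mulr_ge0 ?sqr_ge0// ltW.
  - apply: measurable_funeM; apply/measurable_EFinP; exact: measurable_funX.
  rewrite ge0_integralZl_EFin//; last 2 first.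
  - by move=> x _; rewrite lee_fin sqr_ge0.
  - by apply/measurable_EFinP; exact: measurable_funX.
  rewrite -EFin_innerL2// -normL2_sqr//.
  rewrite (_ : (\int[mu]_(_ in D) _)%E = ((2^-1 ^+ j)%:E * d%:E)%E); last first.
    by rewrite -muDE -integral_cst.
  rewrite -!EFinM -EFinD lee_fin mulrDr mulr1 lerD2r.
  have := Hu j; rewrite -[u j.+1 \- u j]/(v j) => Hj.
  have : normL2 D (v j) ^+ 2 <= (2^-1 ^+ j) ^+ 2.
    by rewrite lerXn2r ?nnegrE ?normL2_ge0// exprn_ge0.
  rewrite -(ler_pM2l w0) => /le_trans; apply.
  by rewrite exprVn expr2 mulrA divff ?mul1r// gt_eqF.
have sumfin : (\int[mu]_(x in D) (\sum_(0 <= j <oo) `|v j x|%:E) < +oo)%E.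
  rewrite integral_nneseries//.
  apply: (@le_lt_trans _ _ (2 * (1 + d))%:E); last by rewrite ltry.
  apply: nneseries_le => [k|n]; first exact: integral_ge0.
  apply: (le_trans (lee_sum _ (fun (i : 'I_n) _ => intv i))).
  rewrite sumEFin lee_fin -mulr_suml ler_wpM2r//.
    by rewrite addr_ge0.
  have := @geometric_le_lim R n 1 2^-1 ler01.
  rewrite ger0_norm// invr_gt0 invf_lt1// ltr0n ltr1n => /(_ isT isT).
  rewrite (_ : series _ n = \sum_(i < n) 2^-1 ^+ i); last first.
    by rewrite seriesEord; apply: eq_bigr => i _; rewrite /= mul1r.
  move=> /le_trans; apply; rewrite le_eqVlt; apply/orP; left; apply/eqP.
  by field.
have Iv : mu.-integrable D (fun x => \sum_(0 <= j <oo) `|v j x|%:E)%E.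
  apply/integrableP; split.
    by apply: ge0_emeasurable_sum => // k x _ _; rewrite lee_fin.
  apply: le_lt_trans sumfin; rewrite le_eqVlt; apply/orP; left; apply/eqP.
  by apply: eq_integral => x _; rewrite gee0_abs// nneseries_ge0.
have := integrable_ae mD Iv; apply: filterS => x + Dx => /(_ Dx).
rewrite ge0_fin_numE ?nneseries_ge0// => /is_cvg_normed_series cv.
have -> : (fun j => u j x) = (fun j => u 0 x + series (v ^~ x) j).
  apply/funext => j; rewrite /series/= telescope_sumr//; ring.
by apply: is_cvgD => //; exact: is_cvg_cst.
Qed.

(** A rapidly Cauchy subsequence converges almost everywhere, and Fatou's lemma carries the Cauchy
    bound over to its pointwise limit. *)
Lemma L2_complete u : (forall n, L2 D (u n)) -> cauchyL2 u ->
  exists f, cvgL2 D u f.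
Proof.
move=> Lu Cu.
have /choice[N HN] j : exists N, forall m n, (N <= m)%N -> (N <= n)%N ->
    normL2 D (u m \- u n) <= 2^-1 ^+ j.
  by apply: Cu; rewrite exprn_gt0// invr_gt0.
(* Partial sums of [N] dominate [N] and are nondecreasing. *)
pose r j := (\sum_(i < j.+1) N i)%N.
have Nr j : (N j <= r j)%N by rewrite /r big_ord_recr/= leq_addl.
have rS j : (r j <= r j.+1)%N by rewrite /r [leqRHS]big_ord_recr/= leq_addr.
have r_homo : {homo r : i j / (i <= j)%N}.
  exact: (homo_leq leqnn leq_trans rS).
pose w j := u (r j); have Lw j : L2 D (w j) by exact: Lu.
have aecvg : {ae mu, forall x, D x -> cvgn (fun j => w j x)}.
  apply: ae_cvg_fast_subsequence => // j; apply: HN => //.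
  by apply: leq_trans (rS j).
(* The upper limit is measurable whether or not the sequence converges; [fine] sends infinite values
   to 0, which can only occur on the exceptional null set within [D]. *)
pose f (x : RT) : R := fine (limn_esup (fun j => (w j x)%:E)).
have mf : measurable_fun D f.
  apply: (measurableT_comp (fine_measurable measurableT)).
  apply: measurable_fun_limn_esup => j; apply/measurable_EFinP.
  exact: (L2_measurable mD (Lw j)).
have aef : {ae mu, forall x, D x -> w j x @[j --> \oo] --> f x}.
  apply: filterS aecvg => x + Dx => /(_ Dx) cw.
  have cwE : (w j x)%:E @[j --> \oo] --> (limn (fun j => w j x))%:E.
    by apply: cvg_EFin; [exact: nearW|exact: cw].
  by rewrite /f (cvg_limn_einf_sup cwE).2.
have bound i n : (r i <= n)%N ->
    (\int[mu]_(x in D) ((u n x - f x) ^+ 2)%:E <= ((2^-1 ^+ i) ^+ 2)%:E)%E.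
  move=> rin.
  have mg j : measurable_fun D (fun x : RT => ((u n x - w j x) ^+ 2)%:E).
    apply/measurable_EFinP; apply: measurable_funX.
    by apply: measurable_funB; exact: (L2_measurable mD).
  have g0 j (x : RT) : D x -> (0 <= ((u n x - w j x) ^+ 2)%:E)%E.
    by move=> _; rewrite lee_fin sqr_ge0.
  (* The limit is rewritten as a lower limit, the form required by Fatou's lemma. *)
  have -> : (\int[mu]_(x in D) ((u n x - f x) ^+ 2)%:E =
     \int[mu]_(x in D) limn_einf (fun j => ((u n x - w j x) ^+ 2)%:E))%E.
    apply: ae_eq_integral => //.
    - apply/measurable_EFinP; apply: measurable_funX.
      apply: measurable_funB => //.
      exact: (L2_measurable mD (Lu n)).
    - under eq_fun => x do rewrite -[limn_einf _]oppeK -limn_esupN.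
      apply: measurableT_comp => //; apply: measurable_fun_limn_esup => j.
      exact: measurableT_comp.
    - apply: filterS aef => x + Dx => /(_ Dx) cw.
      suff c : ((u n x - w j x) ^+ 2)%:E @[j --> \oo] -->
          ((u n x - f x) ^+ 2)%:E.
        by rewrite (cvg_limn_einf_sup c).1.
      apply: cvg_EFin; first exact: nearW.
      have c : u n x - w j x @[j --> \oo] --> u n x - f x.
        by apply: cvgB => //; exact: cvg_cst.
      exact: (cvgM c c).
  apply: (le_trans (fatou mu mD mg g0)).
  rewrite limn_einf_lim; apply: lime_le; first exact: is_cvg_einfs.
  near=> j.
  apply: (@le_trans _ _ (\int[mu]_(x in D) ((u n x - w j x) ^+ 2)%:E)%E).
    by apply: ereal_inf_lbound; exists j => /=.
  have ij : (i <= j)%N by near: j; exact: nbhs_infty_ge.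
  have Luw := L2_sub (Lu n) (Lw j).
  rewrite -(EFin_innerL2 mD Luw) -(normL2_sqr mD Luw) lee_fin.
  rewrite lerXn2r ?nnegrE ?normL2_ge0 ?exprn_ge0//.
  by apply: HN; [exact: leq_trans rin|exact: leq_trans (Nr i) (r_homo _ _ ij)].
have Luf n i : (r i <= n)%N -> L2 D (u n \- f).
  move=> /bound rin; apply/L2P => //; split.
    by apply: measurable_funB => //; exact: (L2_measurable mD (Lu n)).
  apply/integrableP; split.
    apply/measurable_EFinP; apply: measurable_funX.
      apply: measurable_funB => //.
    exact: (L2_measurable mD (Lu n)).
  apply: (@le_lt_trans _ _ ((2^-1 ^+ i) ^+ 2)%:E); last by rewrite ltry.
  apply: le_trans rin; rewrite le_eqVlt; apply/orP; left; apply/eqP.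
  by apply: eq_integral => x _ /=; rewrite ger0_norm ?sqr_ge0.
have Lf : L2 D f.
  have := L2_sub (Lu (r 0%N)) (Luf (r 0%N) 0%N (leqnn _)).
  by congr (L2 D _); apply/funext => x /=; ring.
exists f; split=> //; apply/cvgr0Pnorm_le => e e0.
have [i ie] : exists i, 2^-1 ^+ i <= e.
  have := @cvg_expr R 2^-1; rewrite ger0_norm// invf_lt1// ltr1n => /(_ isT).
  move=> /cvgr0Pnorm_le/(_ e e0)[i _ /(_ i (leqnn i))].
  by rewrite ger0_norm ?exprn_ge0//; exists i.
near=> n; rewrite ger0_norm ?normL2_ge0//; apply: le_trans ie.
have rin : (r i <= n)%N by near: n; exact: nbhs_infty_ge.
rewrite -ler_sqr ?nnegrE ?normL2_ge0 ?exprn_ge0//.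
have Lnf := Luf n i rin.
by rewrite -lee_fin (normL2_sqr mD Lnf) (EFin_innerL2 mD Lnf); exact: bound.
Unshelve. all: by end_near. Qed.

End L2_completeness.

(** * Orthonormal series *)

Section orthonormal_series.
Context {R : realType}.
Local Notation RT := (measurableTypeR R).
Local Notation mu := (@lebesgue_measure R).
Variable D : set RT.
Hypothesis mD : measurable D.
Variable psi : nat -> RT -> R.
Hypothesis Lpsi : forall k, L2 D (psi k).
Hypothesis ortho : forall j k, innerL2 D (psi j) (psi k) = (j == k)%:R.
Implicit Types (f g h : RT -> R) (c : nat -> R) (n : nat).

(** Both the partial sums in [expands] and those of the Tikhonov estimator are convertible to this
    form. *)
Definition orthosum c n : RT -> R := fun x => \sum_(k < n) c k * psi k x.

Lemma L2_orthosum c n : L2 D (orthosum c n).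
Proof. exact: L2_sum. Qed.

Lemma orthosumS c n :
  orthosum c n.+1 = (fun x => c n * psi n x + orthosum c n x).
Proof. by apply/funext => x; rewrite /orthosum big_ord_recr addrC. Qed.

Lemma innerL2_orthosum c n j :
  innerL2 D (orthosum c n) (psi j) = if (j < n)%N then c j else 0.
Proof.
elim: n => [|n IH].
  rewrite /innerL2 (_ : orthosum c 0 = cst 0).
    by under eq_Rintegral do rewrite mul0r; rewrite /Rintegral integral0.
  by apply/funext => x; rewrite /orthosum big_ord0.
rewrite orthosumS innerL2_lin//; last exact: L2_orthosum.
rewrite IH ortho ltnS eq_sym.
by case: (ltngtP j n) => [_|_|->]; rewrite ?mulr0 ?add0r// mulr1 addr0.
Qed.

Lemma normL2_orthosum c n :
  normL2 D (orthosum c n) ^+ 2 = \sum_(k < n) c k ^+ 2.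
Proof.
elim: n => [|n IH].
  rewrite big_ord0 normL2_sqr//; last exact: L2_orthosum.
  rewrite /innerL2 (_ : orthosum c 0 = cst 0).
    by under eq_Rintegral do rewrite mul0r; rewrite /Rintegral integral0.
  by apply/funext => x; rewrite /orthosum big_ord0.
rewrite orthosumS innerL2_lin_sqr//; last exact: L2_orthosum.
rewrite innerL2C innerL2_orthosum ltnn IH normL2_sqr// ortho eqxx.
by rewrite big_ord_recr/=; ring.
Qed.

Lemma orthosumB c c' n :
  orthosum c n \- orthosum c' n = orthosum (fun k => c k - c' k) n.
Proof.
apply/funext => x; rewrite /orthosum /= -sumrB.
by apply: eq_bigr => k _; rewrite mulrBl.
Qed.

Lemma normL2_orthosumB c m n : (m <= n)%N ->
  normL2 D (orthosum c n \- orthosum c m) ^+ 2 =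
    \sum_(k < n) c k ^+ 2 - \sum_(k < m) c k ^+ 2.
Proof.
move=> mn.
have trunc (a : nat -> R) : \sum_(k < m) a k =
    \sum_(k < n) (if (k < m)%N then a k else 0).
  by rewrite (big_ord_widen n a mn) big_mkcond.
(* The shorter sum is a sum of length [n] with its coefficients zeroed from [m] on, so the
   Pythagorean identity applies to the difference. *)
have -> : orthosum c m = orthosum (fun k => if (k < m)%N then c k else 0) n.
  apply/funext => x; rewrite /orthosum (trunc (fun k => c k * psi k x)).
  by apply: eq_bigr => k _; case: ifP; rewrite ?mul0r.
rewrite orthosumB normL2_orthosum (trunc (fun k => c k ^+ 2)) -sumrB.
by apply: eq_bigr => k _; case: ifP; rewrite ?subrr ?subr0// expr0n.
Qed.

Lemma normL2_subC f g : L2 D f -> L2 D g ->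
  normL2 D (f \- g) = normL2 D (g \- f).
Proof.
move=> Lf Lg; rewrite !normL2E//; [|exact: L2_sub..].
by congr Num.sqrt; apply: eq_Rintegral => x _ /=; ring.
Qed.

(** Squared distances between partial sums are differences of the partial sums of c_k^2, a bounded
    monotone sequence; completeness then provides the limit. *)
Lemma riesz_fischer c (B : R) : (mu D < +oo)%E ->
  (forall n, \sum_(k < n) c k ^+ 2 <= B) -> exists f, cvgL2 D (orthosum c) f.
Proof.
move=> finD cB; apply: L2_complete => //; first exact: L2_orthosum.
pose S n := \sum_(k < n) c k ^+ 2.
have ndS : nondecreasing_seq S.
  by apply/nondecreasing_seqP => n; rewrite /S big_ord_recr lerDl sqr_ge0.
have cvgS : cvgn S.
  by apply: nondecreasing_is_cvgn => //; exists B => _ [n _ <-]; exact: cB.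
move=> e e0; have e20 : 0 < e ^+ 2 by rewrite exprn_gt0.
have /cvgrPdist_lt/(_ _ e20)[N _ HN] := cvgS.
exists N.
suff H m n : (N <= m)%N -> (m <= n)%N ->
    normL2 D (orthosum c n \- orthosum c m) <= e.
  move=> m n Nm Nn; case/orP: (leq_total m n) => mn.
    by rewrite normL2_subC ?H//; exact: L2_orthosum.
  exact: H.
move=> Nm mn; rewrite -ler_sqr ?nnegrE ?normL2_ge0 ?(ltW e0)//.
rewrite normL2_orthosumB// -/(S n) -/(S m).
have Sle : S n <= limn S by exact: nondecreasing_cvgn_le.
have := HN m Nm; rewrite /= ger0_norm; first by lra.
by rewrite subr_ge0; exact: nondecreasing_cvgn_le.
Qed.

(** The j-th coefficient of the partial sums is constant once their length exceeds [j], and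
    Cauchy-Schwarz passes it to the limit. *)
Lemma cvg_orthosum_coef c f j : cvgL2 D (orthosum c) f ->
  innerL2 D f (psi j) = c j.
Proof.
case=> _ Lf cf; apply/eqP; rewrite eq_sym -subr_eq0 -normr_le0.
apply/ler_addgt0Pr => e e0; rewrite add0r.
have /cvgr0Pnorm_le/(_ _ e0)[N _ HN] := cf.
have jn : (j < maxn N j.+1)%N by rewrite leq_max leqnn orbT.
have := HN (maxn N j.+1) (leq_maxl _ _).
rewrite /= ger0_norm ?normL2_ge0//; apply: le_trans.
have Ls := L2_orthosum c (maxn N j.+1).
have := cauchy_schwarz_L2 mD (L2_sub Ls Lf) (Lpsi j).
rewrite [normL2 D (psi j)]normL2E// ortho eqxx sqrtr1 mulr1; apply: le_trans.
rewrite -[X in X - _](_ : innerL2 D (orthosum c (maxn N j.+1)) (psi j) = c j);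
  last by rewrite innerL2_orthosum jn.
rewrite le_eqVlt; apply/orP; left; apply/eqP; congr `|_|.
rewrite (_ : _ \- _ = (fun x => (-1) * f x + orthosum c (maxn N j.+1) x)).
  by rewrite innerL2_lin//; ring.
by apply/funext => x /=; ring.
Qed.

(** Converts a bound on coefficients into a bound on the distance of the limits, by the triangle
    inequality through partial sums of a common length. *)
Lemma cvg_orthosum_dist c c' f f' (B : R) :
  cvgL2 D (orthosum c) f -> cvgL2 D (orthosum c') f' ->
  (forall n, \sum_(k < n) (c k - c' k) ^+ 2 <= B) ->
  normL2 D (f \- f') ^+ 2 <= B.
Proof.
move=> [_ Lf cf] [_ Lf' cf'] HB.
have B0 : 0 <= B by have := HB 0%N; rewrite big_ord0.
rewrite -[leRHS]sqr_sqrtr// ler_sqr ?nnegrE ?normL2_ge0 ?sqrtr_ge0//.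
apply/ler_addgt0Pr => e e0; have e20 : 0 < e / 2 by rewrite divr_gt0.
have /cvgr0Pnorm_le/(_ _ e20)[N _ HN] := cf.
have /cvgr0Pnorm_le/(_ _ e20)[N' _ HN'] := cf'.
have := HN (maxn N N') (leq_maxl _ _); have := HN' (maxn N N') (leq_maxr _ _).
set n := maxn N N'; rewrite /= !ger0_norm ?normL2_ge0// => h' h.
have Ls := L2_orthosum c n; have Ls' := L2_orthosum c' n.
have hB : normL2 D (orthosum c n \- orthosum c' n) <= Num.sqrt B.
  rewrite orthosumB -ler_sqr ?nnegrE ?normL2_ge0 ?sqrtr_ge0//.
  by rewrite sqr_sqrtr// normL2_orthosum.
have -> : f \- f' = ((f \- orthosum c n) \+ (orthosum c n \- orthosum c' n)) \+
    (orthosum c' n \- f').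
  by apply/funext => x /=; ring.
apply: le_trans (minkowski_L2 mD _ _) _; [|exact: L2_sub|].
  by apply: L2_add => //; exact: L2_sub.
have := minkowski_L2 mD (L2_sub Lf Ls) (L2_sub Ls Ls').
rewrite (normL2_subC Lf Ls); lra.
Qed.

End orthonormal_series.

(** * Smoothness exponents *)

Section smoothness.
Context {R : realType}.
Local Notation RT := (measurableTypeR R).
Local Notation mu := (@lebesgue_measure R).
Implicit Types (D : set RT) (psi : nat -> RT -> R) (phi : RT -> R).

Lemma harmonic_sum_unbounded (B : R) :
  ~ (forall n, \sum_(k < n) k.+1%:R^-1 <= B).
Proof.
move=> HB; apply: (@dvg_harmonic R); apply: nondecreasing_is_cvgn.
  by apply/nondecreasing_seqP => n; rewrite seriesSr lerDl /= invr_ge0.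
by exists B => _ [n _ <-]; rewrite seriesEord; exact: HB.
Qed.

Lemma sobolev_sum_infty D psi phi (a nu : R) : 0 < a ->
  (forall k : nat, a * k.+1%:R^-1 <=
     k.+1%:R `^ (2 * nu) * innerL2 D phi (psi k) ^+ 2) ->
  ~ (sobolev_sum D psi nu phi < +oo)%E.
Proof.
move=> a0 Ha Hfin.
have [|B HB] := nneseries_fin_bound _ Hfin.
  by move=> k; rewrite mulr_ge0 ?powR_ge0 ?sqr_ge0.
apply: (@harmonic_sum_unbounded (a^-1 * B)) => n.
rewrite -ler_pdivrMl ?invr_gt0// invrK mulr_sumr; apply: le_trans (HB n).
by apply: ler_sum => k _; exact: Ha.
Qed.

(** The member [phi] itself refutes every nu > bt - 1/2: its terms are at least a1^2 k^(2 nu - 2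
    bt), which dominates a1^2 / k. *)
Lemma smoothness_exponent_pow D psi phi (bt a1 a2 beta : R) : 0 < a1 ->
  in_source_class D psi (Pow bt a1 a2) phi ->
  smoothness_exponent D psi (Pow bt a1 a2) = beta%:E -> beta <= bt - 2^-1.
Proof.
move=> a10 phiF; rewrite -lee_fin => <-.
apply: ge_ereal_sup => _ [nu [nu0 Hnu] <-].
rewrite lee_fin leNgt; apply/negP => btnu.
have a20 : 0 < a1 ^+ 2 by rewrite exprn_gt0.
apply: (sobolev_sum_infty a20 _ (Hnu _ phiF)) => k.
have k0 : 0 < k.+1%:R :> R by rewrite ltr0n.
have /andP[+ _] := phiF.2 k.
rewrite -ler_sqr ?nnegrE ?mulr_ge0 ?powR_ge0 ?(ltW a10)//.
rewrite real_normK ?num_real// => Hk.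
apply: le_trans (ler_wpM2l (powR_ge0 _ _) Hk).
rewrite exprMn mulrCA ler_wpM2l ?(ltW a20)//.
rewrite -(@powR_mulrn _ (_ `^ _)) ?powR_ge0// -powRrM -powRD; last first.
  by apply/implyP => _; rewrite gt_eqF.
rewrite -powR_inv1 ?(ltW k0)// ler_powR ?ler1n//; lra.
Qed.

Lemma smoothness_exponent_sob D psi (bt E beta : R) :
  measurable D -> (mu D < +oo)%E -> (forall k, L2 D (psi k)) ->
  (forall j k, innerL2 D (psi j) (psi k) = (j == k)%:R) ->
  0 < bt -> 0 < E ->
  smoothness_exponent D psi (Sob bt E) = beta%:E -> beta <= bt.
Proof.
move=> mD finD Lpsi ortho bt0 E0.
rewrite -lee_fin => <-; apply: ge_ereal_sup => _ [nu [nu0 Hnu] <-].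
rewrite lee_fin leNgt; apply/negP => btnu.
(* The witness [c_k^2 ~ k^(- 2 bt - 1 - (nu - bt))] lies in the class, while
   its Sobolev sum of order nu dominates the harmonic series. *)
pose p := 1 + (nu - bt); have p1 : 1 < p by rewrite /p; lra.
have [C [C0 HC]] := @sum_powR_tail R p p1.
have EC0 : 0 < E / C by rewrite divr_gt0.
(* The factor E / C normalizes the Sobolev sum of order bt to at most E, as [C] bounds the sum of
   k^(-p). *)
pose c (k : nat) : R := Num.sqrt (E / C * k.+1%:R `^ (- (2 * bt) - p)).
have k0 (k : nat) : 0 < k.+1%:R :> R by rewrite ltr0n.
have c2 k : c k ^+ 2 = E / C * k.+1%:R `^ (- (2 * bt) - p).
  by rewrite sqr_sqrtr// mulr_ge0 ?powR_ge0// ltW.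
have kD (k : nat) (x y : R) :
    k.+1%:R `^ x * k.+1%:R `^ y = k.+1%:R `^ (x + y) :> R.
  by rewrite -powRD//; apply/implyP => _; rewrite gt_eqF.
have sumE n : \sum_(k < n) k.+1%:R `^ (2 * bt) * c k ^+ 2 <= E.
  have := HC 1 n (lexx 1); rewrite powR1 mulr1 => HCn.
  rewrite [leRHS](_ : _ = E / C * C); last by rewrite divfK ?gt_eqF.
  apply: le_trans (ler_wpM2l (ltW EC0) HCn).
  rewrite mulr_sumr; apply: ler_sum => k _; rewrite c2 ler1n/= mulrCA kD.
  by rewrite addrA subrr add0r.
have sumc n : \sum_(k < n) c k ^+ 2 <= E.
  apply: le_trans (sumE n); apply: ler_sum => k _.
  rewrite ler_peMl ?sqr_ge0// -[leLHS](powRr0 k.+1%:R) ler_powR ?ler1n//.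
  by rewrite mulr_ge0// ltW.
have [f cf] := riesz_fischer mD Lpsi ortho finD sumc.
have fc : (fun k => innerL2 D f (psi k)) = c.
  by apply/funext => k; exact: (cvg_orthosum_coef mD Lpsi ortho _ cf).
have fF : in_source_class D psi (Sob bt E) f.
  split.
    rewrite /expands.
    rewrite -[X in cvgL2 _ X _]/(orthosum psi (fun k => innerL2 D f (psi k))).
    by rewrite fc.
  apply: nneseries_le => [k|n].
    by rewrite lee_fin mulr_ge0 ?powR_ge0 ?sqr_ge0.
  rewrite sumEFin lee_fin; apply: le_trans (sumE n).
  by apply: ler_sum => k _; rewrite -fc.
apply: (sobolev_sum_infty EC0 _ (Hnu _ fF)) => k.
rewrite (congr1 (@^~ k) fc) c2 mulrCA ler_wpM2l ?(ltW EC0)// kD.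
rewrite -powR_inv1 ?(ltW (k0 k))// ler_powR ?ler1n// /p; lra.
Qed.

(** The upper bounds on [beta] transfer membership from the nominal exponent to [beta]: k^(2 beta)
    <= k^(2 bt) for Sobolev classes, k^(-2 bt) <= k^(-(2 beta + 1)) for power classes. The constant
    precedes the domain, the basis and the solution, which makes it uniform in them. *)
Lemma source_bias_le (s gamma clo beta : R) (F : source_class) : 0 <= s ->
    0 < gamma -> 0 < clo -> 0 < beta -> beta != gamma * (s + 1) ->
    source_class_valid F ->
  exists C : R, 0 < C /\ forall D psi phi chi lam lambda K n,
    measurable D -> (mu D < +oo)%E -> (forall k, L2 D (psi k)) ->
    (forall j k, innerL2 D (psi j) (psi k) = (j == k)%:R) ->
    spectral_decay gamma clo chi lam ->
    1 <= K -> lambda ^+ 2 = K `^ (- (gamma * (s + 1))) ->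
    in_source_class D psi F phi -> smoothness_exponent D psi F = beta%:E ->
    \sum_(k < n) (tikhonov_weight s lambda (lam k) * lam k - 1) ^+ 2
        * innerL2 D phi (psi k) ^+ 2
      <= C * K `^ (- (2 * Num.min beta (gamma * (s + 1)))).
Proof.
move=> s0 g0 clo0 b0 bna; set a := gamma * (s + 1).
have a0 : 0 < a by rewrite mulr_gt0//; lra.
case: F => [bt E [bt0 E0]|bt a1 a2 [bt2 a10 a12]].
  have mI : 0 <= Num.min beta a <= gamma * (s + 1).
    by rewrite ge_min lexx orbT le_min !ltW.
  have mb : Num.min beta a <= beta by rewrite ge_min lexx.
  have [C [C0 HC]] := bias_sum_sobolev_le s0 g0 clo0 mI mb E0.
  exists C; split=> // D psi phi chi lam lambda K n.
  move=> mD finD Lpsi ortho dec K1 LE.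
  move=> [_ phiF] /(smoothness_exponent_sob mD finD Lpsi ortho bt0 E0) bbt.
  apply: (HC chi lam lambda K (fun k => innerL2 D phi (psi k)) n) => //.
  rewrite -lee_fin; apply: le_trans phiF; rewrite -sumEFin.
  apply: le_trans (nneseries_ge_partial _ _); last first.
    by move=> k; rewrite lee_fin mulr_ge0 ?powR_ge0 ?sqr_ge0.
  apply: lee_sum => k _; rewrite lee_fin ler_wpM2r ?sqr_ge0//.
  by rewrite ler_powR ?ler1n// ler_pM2l.
have a20 : 0 < a2 by lra.
have a220 : 0 < a2 ^+ 2 by rewrite exprn_gt0.
have [C [C0 HC]] := bias_sum_power_le s0 g0 clo0 b0 bna a220.
exists C; split=> // D psi phi chi lam lambda K n.
  move=> mD finD Lpsi ortho dec K1 LE.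
move=> phiF /(smoothness_exponent_pow a10 phiF) bbt.
apply: (HC chi lam lambda K (fun k => innerL2 D phi (psi k)) n) => // k.
have /andP[_] := phiF.2 k.
rewrite -ler_sqr ?nnegrE ?mulr_ge0 ?powR_ge0 ?(ltW a20)//.
rewrite real_normK ?num_real// => /le_trans; apply.
rewrite exprMn ler_wpM2l ?(ltW a220)//.
rewrite -(@powR_mulrn _ (_ `^ _)) ?powR_ge0// -powRrM ler_powR ?ler1n//; lra.
Qed.

End smoothness.

(** * Mean squared error *)

Section risk.
Context {R : realType}.
Local Notation RT := (measurableTypeR R).
Local Notation mu := (@lebesgue_measure R).

Import HBNNSimple.

(* No measurability of [f]: the squared error of an estimator defined by choice
   of a representative of an L^2 limit need not be measurable in [w]. *)
Lemma ge0_le_integral_ae d (T : measurableType d)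
    (P : {measure set T -> \bar R}) (f g : T -> \bar R) :
  (forall x, (0 <= f x)%E) -> (forall x, (0 <= g x)%E) ->
  measurable_fun setT g -> {ae P, forall x, (f x <= g x)%E} ->
  (\int[P]_x f x <= \int[P]_x g x)%E.
Proof.
move=> f0 g0 mg fg; rewrite ge0_integralTE//.
(* The integral of [f] is a supremum over simple functions below [f]; each of them is measurable and
   can be compared with [g] almost everywhere. *)
apply: ge_ereal_sup => _ [h hf <-].
have -> : sintegral P h = (\int[P]_x (h x)%:E)%E.
  by rewrite integral_nnsfun// patch_setT.
apply: ae_ge0_le_integral => //.
- by move=> x _; rewrite lee_fin.
- by apply/measurable_EFinP.
- by apply: filterS fg => x fgx _; apply: le_trans fgx; exact: hf.
Qed.

Lemma cvgL2_add (D : set RT) (u v : nat -> RT -> R) (f g : RT -> R) :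
  measurable D -> cvgL2 D u f -> cvgL2 D v g ->
  cvgL2 D (fun n => u n \+ v n) (f \+ g).
Proof.
move=> mD [Lu Lf uf] [Lv Lg vg]; split=> [n||]; [exact: L2_add..|].
have : normL2 D (u n \- f) + normL2 D (v n \- g) @[n --> \oo] --> (0 : R).
  by rewrite -[0]addr0; exact: cvgD.
apply: squeeze_cvgr; last exact: cvg_cst.
apply: nearW => n; rewrite normL2_ge0/=.
have -> : (u n \+ v n) \- (f \+ g) = (u n \- f) \+ (v n \- g).
  by apply/funext => x /=; ring.
by apply: minkowski_L2 => //; exact: L2_sub.
Qed.

(** A single random majorant [G] yields both conclusions. Its expectation is bounded by twice the
    bias plus twice the variance, so it is almost surely finite; where finite, it makes the
    coefficient errors square summable and bounds the squared error. *)
Lemma tikhonov_risk_le (S : set RT) (M : nat) (s : R)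
    (A : (R -> R) -> 'I_M -> R -> R) (lam : nat -> R) (psi : nat -> R -> R)
    (phi : R -> R) (lambda tau B V : R)
    d (T : measurableType d) (P : probability T R)
    (eps b : ('I_M -> R -> R) -> {RV P >-> R}) :
  measurable S -> (mu S < +oo)%E -> (forall k, L2 S (psi k)) ->
  (forall j k, innerL2 S (psi j) (psi k) = (j == k)%:R) ->
  expands S psi phi -> 0 <= tau ->
  (forall k, {ae P, forall w,
     b (A (psi k)) w = lam k * innerL2 S phi (psi k) + eps (A (psi k)) w}) ->
  (forall k, ('E_P[fun w => (eps (A (psi k)) w * eps (A (psi k)) w)%R]
     = (tau * lam k)%:E)%E) ->
  (forall n, \sum_(k < n) (tikhonov_weight s lambda (lam k) * lam k - 1) ^+ 2
     * innerL2 S phi (psi k) ^+ 2 <= B) ->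
  (forall n, \sum_(k < n) tikhonov_weight s lambda (lam k) ^+ 2 * lam k <= V) ->
  let est w := tikhonov S s A lam psi (fun f => b f w) lambda in
  {ae P, forall w, cvgL2 S
     (tikhonov_partial s A lam psi (fun f => b f w) lambda) (est w)} /\
  ('E_P[fun w => (normL2 S (est w \- phi) ^+ 2)%R]
     <= (2 * B + 2 * (tau * V))%:E)%E.
Proof.
move=> mS finS Lpsi ortho phiE tau0 bE epsE HB HV est.
pose th k := innerL2 S phi (psi k).
pose wt k := tikhonov_weight s lambda (lam k).
pose e k w := eps (A (psi k)) w.
pose t k := 2 * ((wt k * lam k - 1) ^+ 2 * th k ^+ 2).
pose G (w : T) := (\sum_(0 <= k <oo)
  ((t k)%:E + (2 * wt k ^+ 2)%:E * (e k w ^+ 2)%:E))%E.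
have t0 k : 0 <= t k by rewrite /t mulr_ge0// mulr_ge0 ?sqr_ge0.
have q0 k : 0 <= 2 * wt k ^+ 2 by rewrite mulr_ge0// sqr_ge0.
have term0 k w : (0 <= (t k)%:E + (2 * wt k ^+ 2)%:E * (e k w ^+ 2)%:E)%E.
  by rewrite -EFinM -EFinD lee_fin addr_ge0// mulr_ge0 ?sqr_ge0.
have me2 k : measurable_fun setT (fun w => (e k w ^+ 2)%:E).
  by apply/measurable_EFinP; apply: measurable_funX.
have mterm k : measurable_fun setT
    (fun w => (t k)%:E + (2 * wt k ^+ 2)%:E * (e k w ^+ 2)%:E)%E.
  by apply: emeasurable_funD => //; exact: measurable_funeM.
have mG : measurable_fun setT G.
  by apply: ge0_emeasurable_sum => // k w _ _; exact: term0.
have G0 w : (0 <= G w)%E by rewrite nneseries_ge0.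
have intG : (\int[P]_w G w <= (2 * B + 2 * (tau * V))%:E)%E.
  rewrite integral_nneseries//.
  apply: nneseries_le => [k|n]; first exact: integral_ge0.
  have intterm k : (\int[P]_w ((t k)%:E + (2 * wt k ^+ 2)%:E * (e k w ^+ 2)%:E)
      = (t k + 2 * wt k ^+ 2 * (tau * lam k))%:E)%E.
    rewrite ge0_integralD//; last 3 first.
    - by move=> w _; rewrite lee_fin.
    - by move=> w _; rewrite -EFinM lee_fin mulr_ge0 ?sqr_ge0.
    - exact: measurable_funeM.
    have -> : (\int[P]_(_ in setT) (t k)%:E = (t k)%:E)%E.
      have := integral_cst P measurableT (t k)%:E.
      rewrite [X in _ = (_ * X)%E](_ : _ = 1%E); first by rewrite mule1.
      exact: probability_setT.
    rewrite ge0_integralZl_EFin//; last first.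
      by move=> w _; rewrite lee_fin sqr_ge0.
    by rewrite EFinD [in RHS](EFinM (2 * wt k ^+ 2)) -epsE unlock.
  rewrite (eq_bigr _ (fun (i : 'I_n) _ => intterm i)).
  rewrite sumEFin lee_fin big_split/= -mulr_sumr lerD//.
    by rewrite ler_pM2l//; exact: HB.
  have -> : \sum_(k < n) 2 * wt k ^+ 2 * (tau * lam k) =
      2 * (tau * \sum_(k < n) wt k ^+ 2 * lam k).
    by rewrite !mulr_sumr; apply: eq_bigr => k _; ring.
  by rewrite ler_pM2l// ler_wpM2l//; exact: HV.
have Gfin : {ae P, forall w, (G w < +oo)%E}.
  have IG : P.-integrable setT G.
    apply/integrableP; split=> //.
    apply: le_lt_trans (ltry (2 * B + 2 * (tau * V))).
    apply: le_trans intG; rewrite le_eqVlt; apply/orP; left; apply/eqP.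
    by apply: eq_integral => w _; rewrite gee0_abs.
  have := integrable_ae measurableT IG; apply: filterS => w /(_ I).
  by rewrite ge0_fin_numE.
(* The exceptional null set depends on the test function, but only countably many A psi_k occur. *)
have bE' : {ae P, forall w k, b (A (psi k)) w = lam k * th k + e k w}.
  by apply/ae_foralln.
have good : {ae P, forall w,
    cvgL2 S (tikhonov_partial s A lam psi (fun f => b f w) lambda) (est w) /\
    ((normL2 S (est w \- phi) ^+ 2)%:E <= G w)%E}.
  apply: filterS2 Gfin bE' => w Gw bw.
  pose c k := wt k * b (A (psi k)) w.
  have cth n : \sum_(k < n) (c k - th k) ^+ 2 <= fine (G w).
    rewrite -lee_fin fineK ?ge0_fin_numE// -sumEFin.
    apply: le_trans (nneseries_ge_partial n (term0 ^~ w)).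
    (* Here (p + q)^2 <= 2 p^2 + 2 q^2, with the square of p - q as the certificate. *)
    apply: lee_sum => k _; rewrite -EFinM -EFinD lee_fin /c bw /t.
    set x := wt k; set l := lam k; set y := th k; set z := e k w.
    have := sqr_ge0 ((x * l - 1) * y - x * z); nra.
  (* Riesz-Fischer is applied to the error coefficients, whose squares [G] controls; adding the
     expansion of [phi] gives the convergence of the estimator series. *)
  have [g gE] :=
    riesz_fischer mS Lpsi ortho (c := fun k => c k - th k) finS cth.
  have cE : cvgL2 S (orthosum psi c) (g \+ phi).
    have := cvgL2_add mS gE phiE.
    congr (cvgL2 S _ _); apply/funext => n; apply/funext => x /=.
    rewrite /orthosum -big_split/=; apply: eq_bigr => k _.
    by rewrite -mulrDl subrK.
  have estE : cvgL2 S (orthosum psi c) (est w).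
    apply: (@xgetPex _ _ [set f | cvgL2 S (orthosum psi c) f]).
    by exists (g \+ phi).
  split=> //; rewrite -[G w]fineK ?ge0_fin_numE// lee_fin.
  exact: (cvg_orthosum_dist mS Lpsi ortho estE phiE cth).
split; first by apply: filterS good => w [].
apply: le_trans intG; rewrite unlock.
apply: ge0_le_integral_ae => //.
- by move=> w; rewrite lee_fin sqr_ge0.
- by apply: filterS good => w [].
Qed.

End risk.

(** * Convergence rates *)

Section convergence_rate.
Context {R : realType}.
Local Notation RT := (measurableTypeR R).
Local Notation mu := (@lebesgue_measure R).

Lemma bounded_domain_measurable (D : set RT) :
  bounded_domain D -> measurable D.
Proof. by case=> _ oD _ _; exact: open_measurable. Qed.

Lemma bounded_domain_finite_measure (D : set RT) :
  bounded_domain D -> (mu D < +oo)%E.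
Proof.
move=> /[dup] /bounded_domain_measurable mD [_ _ _ [r [_ Hr]]].
have {}Hr : forall x, D x -> `|x| <= r + 1 by apply: Hr; rewrite ltrDl.
apply: (@le_lt_trans _ _ (mu `[- (r + 1), r + 1])).
  apply: le_measure; rewrite ?inE//.
  by move=> x /Hr /=; rewrite in_itv/= ler_norml.
by rewrite lebesgue_measure_itv/=; case: ifP => _; rewrite ?ltry// -EFinB ltry.
Qed.

Lemma eqL2_innerL2r (D : set RT) (f g h : RT -> R) : measurable D ->
  L2 D f -> L2 D g -> L2 D h -> eqL2 D g h -> innerL2 D f g = innerL2 D f h.
Proof.
move=> mD Lf Lg Lh gh; congr fine; apply: ae_eq_integral => //.
- exact: (measurable_int _ (L2_mul_integrable mD Lf Lg)).
- exact: (measurable_int _ (L2_mul_integrable mD Lf Lh)).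
- have gh' : {ae mu, forall x : RT, D x -> g x = h x} := gh.
  by apply: filterS gh' => x + Dx => /(_ Dx)/= ->.
Qed.

(** The cutoff [K] is left abstract, subject to the balance of bias and variance: K^(-2 min(beta,
    a)) and sigma^2 K^(gamma+1) both equal sigma^rate. Each regime then only has to solve these
    equations. *)
Lemma tikhonov_risk_rate (M : nat) (s gamma clo chi beta : R)
    (F : source_class (R := R)) :
  (0 < M)%N -> 0 <= s -> 0 < gamma -> 1 / (s + 1) < gamma ->
  0 < clo -> clo <= chi -> source_class_valid F -> 0 < beta ->
  beta != gamma * (s + 1) ->
  exists C : R, 0 < C /\ forall (S Omega : set R)
      (A : (R -> R) -> 'I_M -> R -> R) (At : ('I_M -> R -> R) -> R -> R)
      (lam : nat -> R) (psi : nat -> R -> R) (phistar : R -> R),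
    bounded_domain S -> bounded_linear S Omega A -> is_adjoint S Omega A At ->
    eigensystem S (fun phi => At (A phi)) lam psi ->
    spectral_decay gamma clo chi lam -> L2 S phistar ->
    in_source_class S psi F phistar ->
    smoothness_exponent S psi F = beta%:E ->
    forall (rate K sigma : R) (lstar : R -> R),
    1 <= K -> 0 < lstar sigma ->
    lstar sigma ^+ 2 = K `^ (- (gamma * (s + 1))) ->
    K `^ (- (2 * Num.min beta (gamma * (s + 1)))) = sigma `^ rate ->
    sigma ^+ 2 * K `^ (gamma + 1) = sigma `^ rate ->
    forall (d : measure_display) (T : measurableType d) (P : probability T R)
      (eps b : ('I_M -> R -> R) -> {RV P >-> R}),
    white_noise Omega sigma eps ->
    weak_data Omega (A phistar) eps b ->
    let est w := tikhonov S s A lam psi (fun f => b f w) (lstar sigma) in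
    {ae P, forall w, cvgL2 S
       (tikhonov_partial s A lam psi (fun f => b f w) (lstar sigma)) (est w)} /\
    ('E_P[fun w => (normL2 S (est w \- phistar) ^+ 2)%R]
       <= (C * sigma `^ rate)%R%:E)%E.
Proof.
move=> M0 s0 g0 sg clo0 cc Fv b0 bna.
have chi0 : 0 < chi by lra.
have [CV [CV0 HV]] := variance_sum_le s0 g0 sg clo0 chi0.
have [CB [CB0 HB]] := source_bias_le s0 g0 clo0 b0 bna Fv.
have M0R : 0 < M%:R :> R by rewrite ltr0n.
exists (2 * CB + 2 * (M%:R^-1 * CV)); split.
  by rewrite addr_gt0// mulr_gt0// mulr_gt0// invr_gt0.
move=> S Omega A At lam psi phi dS [AL _ _] [AtL adj] [_ _ [Lpsi ortho] Npsi _].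
move=> dec Lphi phiF Fb rate K sigma lstar K1 l0 LE HK1 HK2 d T P eps b.
move=> [_ _ cov] data est.
have mS := bounded_domain_measurable dS.
have finS := bounded_domain_finite_measure dS.
have AY k : inY Omega (A (psi k)) by exact: AL.
(* Used twice: with f = phi it gives the signal part of the data, with f = psi_k the variance of the
   noise coefficient. *)
have adjE f k : L2 S f ->
    innerY Omega (A f) (A (psi k)) = lam k * innerL2 S f (psi k).
  move=> Lf; rewrite adj//.
  have LN : L2 S (At (A (psi k))) by exact: AtL.
  rewrite (eqL2_innerL2r mS Lf LN (L2_scale mS (lam k) (Lpsi k)) (Npsi k)).
  rewrite innerL2C [in RHS]innerL2C /innerL2 -RintegralZl//.
    by apply: eq_Rintegral => x _; rewrite mulrA.
  exact: (L2_mul_integrable mS).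
have := @tikhonov_risk_le R S M s A lam psi phi (lstar sigma)
  (sigma ^+ 2 / M%:R) (CB * sigma `^ rate) (CV * K `^ (gamma + 1)) d T P eps b
  mS finS Lpsi ortho phiF.1.
have -> : 2 * (CB * sigma `^ rate) +
    2 * (sigma ^+ 2 / M%:R * (CV * K `^ (gamma + 1))) =
    (2 * CB + 2 * (M%:R^-1 * CV)) * sigma `^ rate.
  have -> : sigma ^+ 2 / M%:R * (CV * K `^ (gamma + 1)) =
    M%:R^-1 * CV * sigma `^ rate by rewrite -HK2; ring.
  by ring.
apply.
- by rewrite divr_ge0 ?sqr_ge0// ltW.
- by move=> k; have := data _ (AY k); rewrite adjE.
- by move=> k; rewrite cov// adjE// ortho eqxx mulr1.
- move=> n; rewrite -HK1; exact: (HB _ _ _ chi lam).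
- by move=> n; exact: (HV lam).
Qed.

End convergence_rate.

(** * Choice of the regularization parameter in the two regimes *)

Lemma near0_right_le1 (R : realType) (P : R -> Prop) :
  (forall x, 0 < x -> x <= 1 -> P x) -> \forall x \near 0^'+, P x.
Proof.
move=> HP; near=> x; apply: HP; first by near: x; exact: nbhs_right_gt.
by near: x; exact: nbhs_right_le.
Unshelve. all: by end_near. Qed.

Lemma same_order_refl (R : realType) (f : R -> R) : same_order f f.
Proof.
by exists 1, 1; split=> //; apply: nearW => x; rewrite mul1r lexx.
Qed.

Theorem theorem3p4 (R : realType) (M : nat) (s gamma clo chi beta : R)
    (F : source_class (R := R)) :
  (0 < M)%N -> 0 <= s ->
  0 < gamma -> 1 / (s + 1) < gamma -> 0 < clo -> clo <= chi ->
  source_class_valid F -> 0 < beta ->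
  exists C1 C2 : R, [/\ 0 < C1, 0 < C2 &
    forall (S Omega : set R) (U : Type) (g : U -> R -> R -> R) (u : 'I_M -> U)
      (At : ('I_M -> R -> R) -> R -> R)
      (lam : nat -> R) (psi : nat -> R -> R) (phistar : R -> R),
    let A := forward S g u in
    let N := fun phi => At (A phi) in
    bounded_domain S -> bounded_domain Omega ->
    forward_integrable S Omega g u -> bounded_linear S Omega A ->
    is_adjoint S Omega A At ->
    compact_operator S N -> positive_semidefinite S N ->
    eigensystem S N lam psi ->
    (forall k : nat, clo * k.+1%:R `^ (- gamma) <= lam k
                       <= chi * k.+1%:R `^ (- gamma)) ->
    kernel_orthogonal S N phistar ->
    in_source_class S psi F phistar ->
    smoothness_exponent S psi F = beta%:E ->
    (gamma > beta / (s + 1) ->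
      exists lstar : R -> R,
        [/\ forall sigma : R, 0 < sigma -> 0 < lstar sigma,
            same_order lstar (fun sigma =>
              sigma `^ ((s + 1) * gamma / (2 * beta + gamma + 1))) &
            risk_bound S Omega s A lam psi phistar lstar
              C1 (4 * beta / (2 * beta + gamma + 1))]) /\
    (gamma < beta / (s + 1) ->
      exists lstar : R -> R,
        [/\ forall sigma : R, 0 < sigma -> 0 < lstar sigma,
            same_order lstar (fun sigma =>
              sigma `^ ((s + 1) / (2 * s + 3 + 1 / gamma))) &
            risk_bound S Omega s A lam psi phistar lstar
              C2 (4 * (s + 1) / (2 * s + 3 + 1 / gamma))])].
Proof.
move=> M0 s0 g0 sg clo0 cc Fv b0.
have s1 : 0 < s + 1 by lra.
(* At beta = gamma (s + 1) neither strict inequality holds, so both claims are vacuous and any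
   positive constants do. *)
have [bE|bna] := eqVneq beta (gamma * (s + 1)).
  exists 1, 1; split=> // S Omega U g u At lam psi phi A N *.
  by split; rewrite bE mulfK ?gt_eqF// ltxx.
have [C [C0 HC]] := tikhonov_risk_rate M0 s0 g0 sg clo0 cc Fv b0 bna.
exists C, C; split=> // S Omega U g u At lam psi phi A N dS _ _ bA adjA _ _ eig.
move=> dec [Lphi _] phiF Fb.
(* Taking [lstar] to be exactly sigma^x reduces each regime to identities between exponents for
   sigma in (0, 1], the range in which K >= 1. *)
have risk x rate K :
    (forall sigma, 0 < sigma -> sigma <= 1 ->
      [/\ 1 <= K sigma, (sigma `^ x) ^+ 2 = K sigma `^ (- (gamma * (s + 1))),
        K sigma `^ (- (2 * Num.min beta (gamma * (s + 1)))) = sigma `^ rate &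
        sigma ^+ 2 * K sigma `^ (gamma + 1) = sigma `^ rate]) ->
    exists lstar : R -> R,
      [/\ forall sigma : R, 0 < sigma -> 0 < lstar sigma,
          same_order lstar (fun sigma => sigma `^ x) &
          risk_bound S Omega s A lam psi phi lstar C rate].
  move=> HK; exists (fun sigma => sigma `^ x); split.
  - by move=> sigma ?; exact: powR_gt0.
  - exact: same_order_refl.
  - apply: near0_right_le1 => sigma sigma0 sigma1.
    have [K1 LE K2 K3] := HK sigma sigma0 sigma1.
    move=> d T P eps b wn wd.
    exact: (HC S Omega A At lam psi phi dS bA adjA eig dec Lphi phiF Fb
      rate (K sigma) sigma (fun sigma => sigma `^ x) K1 (powR_gt0 _ sigma0)
      LE K2 K3 d T P eps b wn wd).
have pow_ge1 (sigma y : R) : 0 < sigma -> sigma <= 1 -> 0 <= y ->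
    1 <= sigma `^ (- y).
  move=> sigma0 sigma1 y0; rewrite -[leLHS](powRr0 sigma).
  by apply: ger_powR; [rewrite sigma0|rewrite oppr_le0].
have sqrD (sigma y : R) : 0 < sigma ->
    sigma ^+ 2 * sigma `^ y = sigma `^ (2 + y).
  move=> sigma0; rewrite powRD; last by apply/implyP => _; rewrite gt_eqF.
  by rewrite -[2 in RHS]/(2%:R) powR_mulrn// ltW.
have sqrM (sigma y : R) : (sigma `^ y) ^+ 2 = sigma `^ (y * 2).
  by rewrite powRrM powR_mulrn ?powR_ge0.
split=> [bg|gb].
  have ba : beta < gamma * (s + 1) by rewrite -ltr_pdivrMr.
  have D0 : 0 < 2 * beta + gamma + 1 by lra.
  (* This [K] solves K^(-2 beta) = sigma^2 K^(gamma + 1). *)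
  apply: (risk _ _ (fun sigma => sigma `^ (- (2 / (2 * beta + gamma + 1))))).
  move=> sigma sigma0 sigma1; rewrite (min_l (ltW ba)) sqrM -!powRrM sqrD//.
  split; first by rewrite pow_ge1// divr_ge0// ltW.
  - by congr (_ `^ _); field; rewrite gt_eqF.
  - by congr (_ `^ _); field; rewrite gt_eqF.
  - by congr (_ `^ _); field; rewrite gt_eqF.
have ab : gamma * (s + 1) < beta by rewrite -ltr_pdivlMr.
have z0 : 0 < 2 * s + 3 + 1 / gamma by rewrite addr_gt0 ?divr_gt0//; lra.
(* In the saturated regime [K] solves K^(-2a) = sigma^2 K^(gamma + 1), where 2a + gamma + 1 = gamma
   (2s + 3 + 1/gamma). *)
apply: (risk _ _ (fun sigma =>
  sigma `^ (- (2 / (gamma * (2 * s + 3 + 1 / gamma)))))).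
have zE : gamma * (2 * s + 3 + 1 / gamma) = gamma * (2 * s + 3) + 1.
  by field; rewrite gt_eqF.
have zE' : 2 * s + 3 + 1 / gamma = (gamma * (2 * s + 3) + 1) / gamma.
  by field; rewrite gt_eqF.
have D0 : 0 < gamma * (2 * s + 3) + 1 by rewrite addr_gt0 ?mulr_gt0//; lra.
move=> sigma sigma0 sigma1.
rewrite (min_r (ltW ab)) sqrM -!powRrM sqrD// zE zE'.
split; first by rewrite pow_ge1// divr_ge0// ltW.
- by congr (_ `^ _); field; rewrite !gt_eqF.
- by congr (_ `^ _); field; rewrite !gt_eqF.
- by congr (_ `^ _); field; rewrite !gt_eqF.
Qed.
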